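(* Let $\mathbf e=(e_1,\dots,e_n)$ be a vector of positive integers, let $r=\gcd(e_1,\dots,e_n)$ and let $\mathbf e=r\cdot\mathbf e'$. The Betti diagrams $\beta_{E(\mathbf e')^{(r)}}(\mathbf a)$, where $\mathbf a$ varies over $\mathbb Z^n$, form a basis for the lattice of integral points in $L'(\mathbf e)$. Moreover $\beta_{E(\mathbf e')^{(r)}}$ is, up to sign and twist with $\mathbf a\in\mathbb Z^n$, the unique element in $L'(\mathbf e)$ with this property. In particular, the $\beta_{E(\mathbf e')^{(r)}}(\mathbf a)$, where $\mathbf a$ varies over $\mathbb Z^n$, form a basis for the $\mathbb Q$-vector space $L'(\mathbf e)$.
   Context: A ($\mathbb Z^n$-graded) diagram is an element $\beta=\{\beta_{i,\mathbf a}\}_{i=0,\dots,n,\ \mathbf a\in\mathbb Z^n}$ of $\bigoplus_{\mathbf a\in\mathbb Z^n}\mathbb Q^{n+1}$. Its Betti polynomials are the Laurent polynomials $B_i(t)=\sum_{\mathbf a}\beta_{i,\mathbf a}t^{\mathbf a}$, $i=0,\dots,n$; a diagram is determined by the tuple $(B_0,\dots,B_n)$. With $|\mathbf a|=\sum a_i$, a diagram is pure with difference vector $\mathbf e$ when taking total degrees if there are integers $d_0<\cdots<d_n$ with $d_i-d_{i-1}=e_i$ and $\beta_{i,\mathbf a}=0$ unless $|\mathbf a|=d_i$. For $k=1,\dots,n$ let $\pi_k(\mathbf a)=(a_1,\dots,\widehat{a_k},\dots,a_n)\in\mathbb Z^{n-1}$. The multigraded Herzog–Kühl equations are: for every $k=1,\dots,n$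 and every $\hat{\mathbf a}\in\mathbb Z^{n-1}$, $\sum_{i,\ \pi_k(\mathbf a)=\hat{\mathbf a}}(-1)^i\beta_{i,\mathbf a}=0$. $L'(\mathbf e)$ is the $\mathbb Q$-vector space generated by all diagrams in $\bigoplus_{\mathbb Z^n}\mathbb Q^{n+1}$ that are pure with difference vector $\mathbf e$ when taking total degrees and satisfy the multigraded Herzog–Kühl equations. Its integral points are the elements with all entries integers. Twist: $\beta(-\mathbf t)$ is the diagram with entry $\beta_{i,\mathbf a-\mathbf t}$ in position $(i,\mathbf a)$. Equivariant resolution: for a vector $\mathbf e$ of positive integers put $\lambda_i=\sum_{j=i+1}^n(e_j-1)$ and, for $i=0,\dots,n$, $\alpha(\mathbf e,i)=(\lambda_1+e_1,\dots,\lambda_i+e_i,\lambda_{i+1},\dots,\lambda_n)$. Over a field $k$ of characteristic $0$, with $S=k[x_1,\dots,x_n]$, $E(\mathbf e)$ is the $GL(n)$-equivariant resolution $S\otimes_kS_{\alpha(\mathbf e,0)}\leftarrow\cdots\leftarrow S\otimes_kS_{\alpha(\mathbf e,n)}$ of an artinian module constructed by Eisenbud–Fløystad–Weyman ($S_\lambda$ is the Schur module of $\lambda$); its $i$-th Betti polynomial is the Schur polynomial $s_{\alpha(\mathbf e,i)}(t_1,\dots,t_n)$. $E(\mathbf e)^{(r)}$ is the complex obtained by substituting $x_i\mapsto x_i^r$; its Betti diagram $\beta_{E(\mathbf e)^{(r)}}$ has $i$-th Betti polynomial $s_{\alpha(\mathbf e,i)}(t_1^r,\dots,t_n^r)$.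 (This diagram depends only on $\mathbf e$ and $r$, and no field enters the definition of $L'(\mathbf e)$.) *)

(* Defs.v *)
From HB Require Import structures.
From mathcomp Require Import all_boot all_order all_algebra.
From mathcomp.multinomials Require Import freeg mpoly.

Set Implicit Arguments.
Unset Strict Implicit.
Unset Printing Implicit Defensive.

Import Order.TTheory GRing.Theory Num.Theory.
Local Open Scope ring_scope.

(* The finitely supported families beta_(i,a), i = 0..n, a in Z^n, i.e. the    *)
(* elements of the direct sum of copies of Q^(n+1) indexed by Z^n; the entry   *)
(* beta_(i,a) is [coeff (i, a) beta].                                          *)
Notation diagram n := {freeg ('I_n.+1 * 'rV[int]_n)%type / rat}.

Definition total_degree (n : nat) (a : 'rV[int]_n) : int := \sum_(k < n) a 0 k.

(* The difference condition reads d_(k+1) - d_k = e_(k+1) with e indexed from  *)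
(* 1; here e is indexed from 0.                                                *)
Definition pure (n : nat) (e : 'I_n -> nat) (beta : diagram n) : Prop :=
  exists d : 'I_n.+1 -> int,
    [/\ forall i j : 'I_n.+1, (i < j)%N -> d i < d j,
        forall k : 'I_n, d (fintype.lift ord0 k) - d (widen_ord (leqnSn n) k) = (e k)%:Z
      & forall (i : 'I_n.+1) (a : 'rV[int]_n),
          total_degree a != d i -> coeff (i, a) beta = 0].

(* [col' k a] is pi_k a: the vector a with its k-th coordinate removed.        *)
Definition herzog_kuhl (n : nat) (beta : diagram n) : Prop :=
  forall (k : 'I_n) (ahat : 'rV[int]_n.-1),
    \sum_(x <- dom beta | col' k x.2 == ahat) (-1) ^+ x.1 * coeff x beta = 0.

(* L'(e): the Q-linear span. Different generators may have different           *)
(* degree sequences d.                                                         *)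
Definition Lprime (n : nat) (e : 'I_n -> nat) (beta : diagram n) : Prop :=
  exists s : seq (rat * diagram n),
    (forall p, p \in s -> pure e p.2 /\ herzog_kuhl p.2) /\
    beta = \sum_(p <- s) p.1 *: p.2.

Definition Lprime_int (n : nat) (e : 'I_n -> nat) (beta : diagram n) : Prop :=
  Lprime e beta /\ forall x, coeff x beta \is a Num.int.

(* The family b is an R-basis of the submodule M of V; a finitely supported    *)
(* family of coefficients is an element c of {freeg I / R}, and [fglift b c]   *)
(* is the linear combination \sum_i c_i *: b i.                                *)
Definition is_basis (R : nzRingType) (V : lmodType R) (M : V -> Prop)
    (I : choiceType) (b : I -> V) : Prop :=
  [/\ forall i, M (b i),
      forall v, M v -> exists c : {freeg I / R}, v = fglift b c
    & forall c : {freeg I / R}, fglift b c = 0 -> c = 0].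

(* [zmodule V] is V as a module over int.                                      *)
Definition is_lattice_basis (V : zmodType) (M : V -> Prop)
    (I : choiceType) (b : I -> V) : Prop :=
  @is_basis int (zmodule V) M I b.

(* beta(t), with entry beta_(i,a+t) in position (i,a), so that beta(-t) has    *)
(* entry beta_(i,a-t) there.                                                   *)
Definition twist (n : nat) (beta : diagram n) (t : 'rV[int]_n) : diagram n :=
  \sum_(x <- dom beta) << coeff x beta *g (x.1, x.2 - t) >>.

(* Cells of the Young diagram of lam: pairs (row k, column j) with j < lam k.  *)
Definition cell (n : nat) (lam : 'I_n -> nat) : finType := {k : 'I_n & 'I_(lam k)}.

Definition semistandard (n : nat) (lam : 'I_n -> nat)
    (T : {ffun cell lam -> 'I_n}) : bool :=
  [forall c : cell lam, forall c' : cell lam,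
     ((tag c == tag c') && (tagged c < tagged c')%N ==> (T c <= T c')%N) &&
     ((tag c < tag c')%N && (tagged c == tagged c' :> nat) ==> (T c < T c')%N)].

Definition schur (n : nat) (lam : 'I_n -> nat) : {mpoly rat[n]} :=
  \sum_(T : {ffun cell lam -> 'I_n} | semistandard T) \prod_(c : cell lam) 'X_(T c).

(* [alpha e i k] is the (k+1)-st entry of alpha(e,i), namely                   *)
(* lambda_(k+1) + e_(k+1) if k+1 <= i and lambda_(k+1) otherwise.              *)
Definition lambda (n : nat) (e : 'I_n -> nat) (k : 'I_n) : nat :=
  (\sum_(j < n | k < j) (e j - 1))%N.

Definition alpha (n : nat) (e : 'I_n -> nat) (i : 'I_n.+1) (k : 'I_n) : nat :=
  (lambda e k + (if k < i then e k else 0))%N.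

(* The diagram with Betti polynomials B_0, ..., B_n.                           *)
Definition diagram_of (n : nat) (B : 'I_n.+1 -> {mpoly rat[n]}) : diagram n :=
  \sum_(i < n.+1) \sum_(m <- msupp (B i))
     << (B i)@_m *g (i, \row_k (m k)%:Z) >>.

(* The Betti diagram of E(e)^(r), whose i-th Betti polynomial is               *)
(* s_alpha(e,i)(t_1^r, ..., t_n^r).                                            *)
Definition betti_equivariant (n : nat) (e : 'I_n -> nat) (r : nat) : diagram n :=
  diagram_of (fun i => schur (alpha e i) \mPo [tuple 'X_j ^+ r | j < n]).

(* Main.v *)
Require Import Defs.
From HB Require Import structures.
From mathcomp Require Import all_boot all_order all_algebra.
From mathcomp Require Import fingroup perm realalg polyrcf zify ring.
From mathcomp.multinomials Require Import freeg mpoly.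

Set Implicit Arguments.
Unset Strict Implicit.
Unset Printing Implicit Defensive.

Import Order.TTheory GRing.Theory Num.Theory.
Local Open Scope ring_scope.


(** Let [n] be the number of variables, put [mu_i = e_(i+1) + ... + e_n]
    ([tail_sum]) and [w(x) = (x^(mu_0), ..., x^(mu_n))].  In a pure diagram the
    Betti polynomial [B_i] is homogeneous of degree [D - mu_i], so setting
    [t_k = 1] loses no information and the Herzog-Kuehl equations become the
    linear system [sum_i (-1)^i t_k^(mu_i) B_i = 0], one equation for each [k]
    ([herzog_kuhl_slide], [slide_relation_poly]).  This form is linear and does
    not mention [D], so it holds on the whole span [L'(e)].  The matrix with
    rows [w(t_k)] has [n] rows and [n + 1] columns, and its kernel over the field
    of fractions is spanned by its signed maximal minors.  By the bialternant
    formula the [i]-th minor is [S_i * prod_(a < b) (t_a^r - t_b^r)], where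
    [S_i = s_alpha(e',i)(t_1^r, ..., t_n^r)] is the [i]-th Betti polynomial of
    the equivariant diagram ([schur_minor]).  Hence [B_i = c S_i] with a rational
    function [c], and the theorem says that [c] is a Laurent polynomial, that it
    is integral when the [B_i] are, and that it is a signed monomial when [B]
    generates as well as [S] does.

    The heart of the matter is that the [S_i] have no common factor
    ([schur_no_common_factor]).  Single out one variable [u] among the [t_k], let
    [R] be the ring of polynomials in the others, [t_1, ..., t_m], and let [p] be
    an irreducible element of [R[u]] dividing all [S_i].  Modulo [p] there is a
    relation [al w(u) + sum_j a_j w(t_j) = 0] with a nonzero constant [al] in [R]
    ([power_relation]).  Derivations of [R[u]] which preserve the ideal of [p]
    move [u] along with [t_j].  Differentiating the relation, and comparing the
    directions [t_j] and [t_l], one finds that if neither [a_j] nor [a_l]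
    vanished modulo [p] then the vectors [w(t_1), ..., w(t_m), w'(t_j), w'(t_l)]
    would be linearly dependent ([relation_pair]).  They are independent: a
    nonzero real polynomial with [N] terms has fewer than [N] positive roots, double
    roots counted twice ([fewnomial_eq0]).  So a single [a_j] survives, whence
    [u^(mu_c) = t_j^(mu_c)] modulo [p] for all [c]; since [r] is the gcd of the
    differences of the [mu_c], [p] divides [u^r - t_j^r].  That factor was already
    split off from the minors, so [p^2] divides the minors, and differentiating
    them once in [u] makes [w(t_1), ..., w(t_m), w'(t_j), w(m + 1)] dependent, which
    is absurd for the same reason ([minors_squarefree]).

    Applied to every variable in turn this shows that [c] has, for each [k], a
    denominator not involving [t_k]; comparison of leading monomials then shows
    that [c] is a polynomial once the [B_i] are ([mpoly_dvd_of_free]).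
    Integrality of [c] holds because the minors have leading coefficient 1 or -1
    ([int_mpoly_cofactor]).  Uniqueness is the determination of the units of the
    ring of integral Laurent polynomials ([monomial_factor]). *)

(** * Branching of Schur polynomials *)

(** The Schur polynomial evaluated in an arbitrary commutative ring: the argument
    needs it at [t_k], at [t_k^r], and at elements of a univariate polynomial ring. *)
Definition schur_eval (A : comNzRingType) (n : nat) (lam : 'I_n -> nat) (x : 'I_n -> A) : A :=
  \sum_(T : {ffun cell lam -> 'I_n} | semistandard T) \prod_(c : cell lam) x (T c).

Definition mkcell (n : nat) (lam : 'I_n -> nat) (k : 'I_n) (j : 'I_(lam k)) : cell lam :=
  Tagged (fun k => 'I_(lam k)) j.

Definition partition_shape (n : nat) (lam : 'I_n -> nat) : Prop :=
  forall p q : 'I_n, (p <= q)%N -> (lam q <= lam p)%N.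

Lemma semistandardP (n : nat) (lam : 'I_n -> nat) (T : {ffun cell lam -> 'I_n}) :
  reflect
    ((forall (k : 'I_n) (j j' : 'I_(lam k)), (j < j')%N ->
        (T (mkcell j) <= T (mkcell j'))%N) /\
     (forall (k k' : 'I_n) (j : 'I_(lam k)) (j' : 'I_(lam k')), (k < k')%N ->
        j = j' :> nat -> (T (mkcell j) < T (mkcell j'))%N))
    (semistandard T).
Proof.
apply: (iffP forallP) => [h|[hr hc] [k j]].
  split=> [k j j' ltj | k k' j j' ltk eqj].
    by have /forallP/(_ (mkcell j'))/andP[/implyP + _] := h (mkcell j);
      apply; rewrite eqxx.
  have /forallP/(_ (mkcell j'))/andP[_ /implyP] := h (mkcell j); apply.
  by rewrite ltk /= eqj eqxx.
apply/forallP=> -[k' j']; apply/andP; split; apply/implyP=> /= /andP[].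
  by move=> /eqP ek; subst k'; apply: hr.
by move=> ltk /eqP eqj; apply: hc.
Qed.

Lemma prod_cell (A : comNzRingType) (n : nat) (lam : 'I_n -> nat) (F : cell lam -> A) :
  \prod_(c : cell lam) F c = \prod_(k < n) \prod_(j < lam k) F (mkcell j).
Proof. by rewrite sig_big_dep /=; apply: eq_bigr => -[k j]. Qed.

Section Branching.
Variables (n : nat) (lam : 'I_n.+1 -> nat).
Hypothesis lam_part : partition_shape lam.
Implicit Types (nu : 'I_n -> nat) (T : {ffun cell lam -> 'I_n.+1}).

Let wid (k : 'I_n) : 'I_n.+1 := fintype.lift ord_max k.

Lemma widE (k : 'I_n) : wid k = k :> nat.
Proof. by rewrite /= /bump (leqNgt n) ltn_ord. Qed.

Lemma wid_lt (k : 'I_n) : (wid k < n)%N.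
Proof. by rewrite widE. Qed.

(** Removing the largest letter from a tableau leaves a tableau of some smaller
    shape; this is the length of its [k]-th row, a maximum because the rows weakly
    increase. *)
Definition inner_width T (k : 'I_n) : nat :=
  \max_(j < lam (wid k) | (T (mkcell j) < n)%N) j.+1.

(** The shapes [nu] for which [lam / nu] is a horizontal strip, that is, a possible
    set of cells filled with the largest letter. *)
Definition interlaced nu : bool :=
  [forall k : 'I_n, (nu k <= lam (wid k))%N && (lam (fintype.lift ord0 k) <= nu k)%N].

Lemma inner_widthP T : semistandard T ->
  forall k (j : 'I_(lam (wid k))), (j < inner_width T k)%N = (T (mkcell j) < n)%N.
Proof.
move=> /semistandardP[hr _] k j; apply/idP/idP => h; last first.
  by apply: (@leq_bigmax_cond _ _ (fun j : 'I_(lam (wid k)) => j.+1) j).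
rewrite ltnNge; apply/negP => hj; move: h; rewrite ltnNge => /negP; apply.
apply/bigmax_leqP => j' hj'; rewrite leqNgt ltnS; apply/negP => le.
move: le; rewrite leq_eqVlt => /orP[/eqP/val_inj e|lt].
  by move: hj'; rewrite -e ltnNge hj.
by move: (hr _ _ _ lt); rewrite leqNgt (leq_trans hj' hj).
Qed.

Lemma inner_width_uniq T nu : (forall k, nu k <= lam (wid k))%N ->
  (forall k (j : 'I_(lam (wid k))), (j < nu k)%N = (T (mkcell j) < n)%N) ->
  forall k, inner_width T k = nu k.
Proof.
move=> le h k; apply/eqP; rewrite eqn_leq; apply/andP; split.
  by apply/bigmax_leqP => j; rewrite -h.
case E : (nu k) => [//|v].
have lt : (v < lam (wid k))%N by rewrite -E.
apply: (@leq_bigmax_cond _ _ (fun j : 'I_(lam (wid k)) => j.+1) (Ordinal lt)).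
by rewrite -h E /=.
Qed.

(** Columns strictly increase, so row [k] has no entry below [k]; in particular the
    last row is filled with the largest letter. *)
Lemma semistandard_last T : semistandard T ->
  forall (k : 'I_n.+1) (j : 'I_(lam k)), (k <= T (mkcell j))%N.
Proof.
move=> /semistandardP[_ hc] k.
have [m] := ubnP (val k); elim: m k => // m IH k ltm j.
case: (posnP k) => [->//|k0].
have lt' : (k.-1 < n.+1)%N by apply: leq_ltn_trans (leq_pred _) _.
have ltj : (j < lam (Ordinal lt'))%N.
  by apply: leq_trans (ltn_ord j) _; apply: lam_part; rewrite /= leq_pred.
have lk : (k.-1 < k)%N by rewrite prednK.
rewrite -(prednK k0); apply: (@leq_ltn_trans (T (mkcell (Ordinal ltj)))).
  by apply: (IH (Ordinal lt')); rewrite /= prednK // -ltnS.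
exact: hc.
Qed.

Lemma inner_width_interlaced T : semistandard T -> interlaced (inner_width T).
Proof.
move=> sT; apply/forallP => k; apply/andP; split.
  by apply/bigmax_leqP.
rewrite leqNgt; apply/negP => lt.
have lt2 : (inner_width T k < lam (wid k))%N.
  by apply: leq_trans lt _; apply: lam_part; rewrite widE lift0.
have := inner_widthP sT (Ordinal lt2); rewrite /= ltnn => /esym/negP; apply.
have /semistandardP[_ hc] := sT.
have hk : (wid k < fintype.lift ord0 k)%N by rewrite widE lift0.
apply: leq_trans (_ : T (mkcell (Ordinal lt)) <= n)%N; last by rewrite -ltnS.
exact: hc.
Qed.

Definition fill_outer nu (U : {ffun cell nu -> 'I_n}) : {ffun cell lam -> 'I_n.+1} :=
  [ffun c => if unlift ord_max (tag c) is Some k then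
               if insub (val (tagged c)) is Some j then wid (U (@mkcell _ nu k j))
               else ord_max
             else ord_max].

Definition restrict_inner nu (T : {ffun cell lam -> 'I_n.+1}) : {ffun cell nu -> 'I_n} :=
  [ffun c => if insub (val (tagged c)) is Some j then
               odflt (tag c) (unlift ord_max (T (@mkcell _ lam (wid (tag c)) j)))
             else tag c].

Lemma fill_outer_in nu (U : {ffun cell nu -> 'I_n}) (k : 'I_n) (j : 'I_(lam (wid k))) (j' : 'I_(nu k)) :
  j = j' :> nat -> @fill_outer nu U (mkcell j) = wid (U (mkcell j')).
Proof.
move=> e; rewrite ffunE /= liftK; case: insubP => [j0 _ ej0|]; last first.
  by rewrite e ltn_ord.
by congr (wid (U (mkcell _))); apply: val_inj; rewrite /= ej0.
Qed.

Lemma fill_outer_out nu (U : {ffun cell nu -> 'I_n}) (k : 'I_n) (j : 'I_(lam (wid k))) :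
  (nu k <= j)%N -> @fill_outer nu U (mkcell j) = ord_max.
Proof.
move=> e; rewrite ffunE /= liftK; case: insubP => [j0 h ej0|//].
by move: h; rewrite ltnNge e.
Qed.

Lemma fill_outer_last nu (U : {ffun cell nu -> 'I_n}) (j : 'I_(lam ord_max)) :
  @fill_outer nu U (mkcell j) = ord_max.
Proof. by rewrite ffunE /= unlift_none. Qed.

Lemma restrict_fill nu U : interlaced nu -> restrict_inner nu (@fill_outer nu U) = U.
Proof.
move=> /forallP int; apply/ffunP => -[k j]; rewrite ffunE /=.
case: insubP => [j0 _ ej0|].
  rewrite (@fill_outer_in nu U k j0 j) ?liftK //.
by have /andP[h _] := int k; rewrite (leq_trans (ltn_ord j) h).
Qed.

Lemma fill_lt nu U : interlaced nu -> forall k (j : 'I_(lam (wid k))),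
  (j < nu k)%N = (@fill_outer nu U (mkcell j) < n)%N.
Proof.
move=> int k j; case: ltnP => h.
  by rewrite (@fill_outer_in nu U k j (Ordinal h)) // wid_lt.
by rewrite fill_outer_out //= ltnn.
Qed.

Lemma fill_semistandard nu U : interlaced nu ->
  semistandard (@fill_outer nu U) = semistandard U.
Proof.
move=> int; have /forallP int' := int.
have lele k : (nu k <= lam (wid k))%N by case/andP: (int' k).
apply/semistandardP/semistandardP => -[hr hc]; split.
- move=> k j j' lt; pose i := widen_ord (lele k) j; pose i' := widen_ord (lele k) j'.
  have := hr _ i i' lt.
  by rewrite (@fill_outer_in nu U k i j) // (@fill_outer_in nu U k i' j') // !widE.
- move=> k k' j j' lt e; pose i := widen_ord (lele k) j; pose i' := widen_ord (lele k') j'.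
  have := hc (wid k) (wid k') i i'; rewrite !widE => /(_ lt e).
  by rewrite (@fill_outer_in nu U k i j) // (@fill_outer_in nu U k' i' j') // !widE.
- move=> k; case: (unliftP ord_max k) => [k0|] -> j j' lt; last first.
    by rewrite !fill_outer_last.
  case: (ltnP j' (nu k0)) => h; last by rewrite (fill_outer_out U h) leq_ord.
  have h2 := ltn_trans lt h.
  rewrite (@fill_outer_in nu U k0 j (Ordinal h2)) // (@fill_outer_in nu U k0 j' (Ordinal h)) //.
  by rewrite !widE; apply: hr.
- move=> k k'; case: (unliftP ord_max k) => [k0|] -> j j' lt e; last first.
    by move: lt; rewrite ltnNge leq_ord.
  have hj : (j < nu k0)%N.
    rewrite e; apply: (leq_trans (ltn_ord j')).
    have /andP[_ h] := int' k0; apply: leq_trans h; apply: lam_part.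
    by rewrite /= /bump add1n -[k0 in (k0 < _)%N]widE.
  rewrite (@fill_outer_in nu U k0 j (Ordinal hj)) //.
  case: (unliftP ord_max k') j' e lt => [k1|] -> j' e lt; last first.
    by rewrite fill_outer_last wid_lt.
  case: (ltnP j' (nu k1)) => h; last by rewrite (fill_outer_out U h) wid_lt.
  rewrite (@fill_outer_in nu U k1 j' (Ordinal h)) //.
  by rewrite !widE; apply: hc => //; rewrite -[k0 in (k0 < _)%N]widE -[X in (_ < X)%N]widE.
Qed.

Lemma fill_prod (A : comNzRingType) (x : 'I_n.+1 -> A) nu U : interlaced nu ->
  \prod_(c : cell lam) x (@fill_outer nu U c) =
  \prod_(c : cell nu) x (wid (U c)) *
    (x ord_max ^+ lam ord_max * \prod_(k < n) x ord_max ^+ (lam (wid k) - nu k)).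
Proof.
move=> int; have /forallP int' := int.
have lele k : (nu k <= lam (wid k))%N by case/andP: (int' k).
rewrite !prod_cell big_ord_recr /=.
rewrite [X in _ * X](_ : _ = x ord_max ^+ lam ord_max); last first.
  rewrite (eq_bigr (fun=> x ord_max)) => [|j _]; last by rewrite fill_outer_last.
  by rewrite prodr_const card_ord.
rewrite mulrCA mulrC; congr (_ * _); rewrite -big_split /=; apply: eq_bigr => k _.
have -> : widen_ord (leqnSn n) k = wid k by apply/val_inj/esym/widE.
pose g (j : nat) := if insub j is Some j0 then x (wid (U (@mkcell _ nu k j0))) else x ord_max.
rewrite (eq_bigr (fun j : 'I_(lam (wid k)) => g j)) => [|j _]; last first.
  rewrite /g; case: insubP => [j0 _ ej0|].
    by rewrite (@fill_outer_in nu U k j j0).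
  by rewrite -leqNgt => h; rewrite fill_outer_out.
rewrite -(big_mkord xpredT g) (big_cat_nat _ (lele k)) //=; congr (_ * _).
  rewrite big_mkord; apply: eq_bigr => j _; rewrite /g; case: insubP => [j0 _ ej0|].
    by congr (x (wid (U (mkcell _)))); apply: val_inj.
  by rewrite ltn_ord.
rewrite big_nat (eq_bigr (fun=> x ord_max)) => [|j /andP[h _]]; last first.
  by rewrite /g insubF // ltnNge h.
by rewrite -big_nat prodr_const_nat.
Qed.

(** A semistandard tableau is the same as a tableau in the smaller alphabet together
    with a horizontal strip of cells containing the largest letter.  The bound [b]
    makes the shapes range over a finite type. *)
Lemma schur_branching (A : comNzRingType) (x : 'I_n.+1 -> A) (b : nat)
    (lam_b : forall k, (lam k < b)%N) :
  schur_eval lam x =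
  \sum_(f : {ffun 'I_n -> 'I_b} | interlaced (fun k => f k))
    schur_eval (fun k => f k) (fun k => x (wid k)) *
    (x ord_max ^+ lam ord_max * \prod_(k < n) x ord_max ^+ (lam (wid k) - f k)).
Proof.
have wb T k : (inner_width T k < b)%N.
  by apply: leq_ltn_trans (lam_b (wid k)); apply/bigmax_leqP.
pose wd (T : {ffun cell lam -> 'I_n.+1}) : {ffun 'I_n -> 'I_b} :=
  [ffun k => Ordinal (wb T k)].
rewrite /schur_eval (partition_big wd (fun f => interlaced (fun k => f k))); last first.
  move=> T sT; have := inner_width_interlaced sT.
  by move=> /forallP h; apply/forallP => k; rewrite ffunE; apply: h.
apply: eq_bigr => f int; rewrite big_distrl /=.
have lele k : (f k <= lam (wid k))%N by move/forallP/(_ k)/andP: int => [].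
rewrite (reindex_onto (@fill_outer (fun k => f k)) (restrict_inner (fun k => f k))); last first.
  move=> T /andP[sT /eqP e]; apply/ffunP => -[k].
  case: (unliftP ord_max k) => [k0|] -> j; last first.
    rewrite fill_outer_last; apply/esym/val_inj/eqP.
    by rewrite eqn_leq leq_ord /=; apply: (semistandard_last sT j).
  have ew : f k0 = inner_width T k0 :> nat by rewrite -e ffunE.
  have := inner_widthP sT j; rewrite -ew; case: (ltnP j (f k0)) => h.
    move=> lt; rewrite (@fill_outer_in _ _ k0 j (Ordinal h)) // ffunE /=.
    case: insubP => [j0 _ ej0|]; last by rewrite ltn_ord.
    have -> : j0 = j by apply: val_inj.
    case: unliftP => [i|] /= E; first by rewrite E.
    by move: lt; rewrite E /= ltnn.
  move=> /esym/negbT; rewrite -leqNgt => le.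
  by rewrite fill_outer_out //; apply/val_inj/eqP; rewrite eqn_leq le leq_ord.
apply: eq_big => [U|U sT'].
  rewrite fill_semistandard // restrict_fill // eqxx andbT; case: (semistandard U) => //=.
  apply/eqP/ffunP => k; rewrite ffunE; apply: val_inj => /=.
  by rewrite (@inner_width_uniq _ (fun k => f k)) //; apply: fill_lt.
by rewrite fill_prod.
Qed.

End Branching.

(** * The bialternant formula *)

Definition alternant (A : comNzRingType) (n : nat) (l : 'I_n -> nat) (x : 'I_n -> A) : A :=
  \det (\matrix_(k < n, p < n) x k ^+ l p).

Definition diff_product (A : comNzRingType) (n : nat) (x : 'I_n -> A) : A :=
  \prod_(i < n) \prod_(j < n | (i < j)%N) (x i - x j).

Lemma diff_product_recr (A : comNzRingType) (n : nat) (x : 'I_n.+1 -> A) :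
  diff_product x = diff_product (fun k => x (fintype.lift ord_max k)) *
                   \prod_(k < n) (x (fintype.lift ord_max k) - x ord_max).
Proof.
have w (k : 'I_n) : widen_ord (leqnSn n) k = fintype.lift ord_max k.
  by apply: val_inj; rewrite /= /bump (leqNgt n) ltn_ord.
rewrite /diff_product big_ord_recr /= [X in _ * X]big_pred0 ?mulr1 => [|j]; last first.
  by rewrite ltnNge leq_ord.
rewrite -big_split /=; apply: eq_bigr => i _.
rewrite big_mkcond big_ord_recr /= ltn_ord -w; congr (_ * _).
by rewrite [RHS]big_mkcond; apply: eq_bigr => j _; rewrite -w.
Qed.

Lemma det_sum_cols (A : comNzRingType) (n : nat) (I : finType) (Q : 'I_n -> pred I)
    (F : 'I_n -> 'I_n -> I -> A) :
  \det (\matrix_(k, p) \sum_(v | Q p v) F k p v) =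
  \sum_(f : {ffun 'I_n -> I} | [forall p, Q p (f p)]) \det (\matrix_(k, p) F k p (f p)).
Proof.
rewrite -det_tr; under [RHS]eq_bigr => f _ do rewrite -det_tr.
rewrite /determinant.
transitivity (\sum_(s : 'S_n) \sum_(f : {ffun 'I_n -> I} | f \in family Q)
   (-1) ^+ s * \prod_(p < n) F (s p) p (f p)).
  apply: eq_bigr => s _; rewrite -mulr_sumr; congr (_ * _).
  rewrite (eq_bigr (fun p => \sum_(v | Q p v) F (s p) p v)) => [|p _]; last by rewrite !mxE.
  exact: bigA_distr_big_dep.
rewrite exchange_big /=; apply: eq_big => [f|f _].
  by apply/familyP/forallP.
by apply: eq_bigr => s _; congr (_ * _); apply: eq_bigr => p _; rewrite !mxE.
Qed.

(** The sum telescopes.  This is the identity that matches the column operations on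
    an alternant with the interlacing conditions. *)
Lemma geometric_difference (A : comNzRingType) (x y : A) (a c s b : nat) :
  (a <= c.+1)%N -> (c < b)%N ->
  (x - y) * \sum_(v < b | (a <= v)%N && (v <= c)%N) x ^+ (v + s) * y ^+ (c - v) =
  x ^+ (c.+1 + s) - y ^+ (c.+1 - a) * x ^+ (a + s).
Proof.
move=> ac cb; rewrite -(big_mkord (fun v => (a <= v)%N && (v <= c)%N)
  (fun v => x ^+ (v + s) * y ^+ (c - v))).
rewrite (eq_bigl (fun v => (xpredT v && (v < c.+1)%N) && (a <= v)%N)); last first.
  by move=> v; rewrite /= ltnS andbC.
rewrite -(@big_nat_widenl _ _ _ a 0 b) // -(@big_nat_widen _ _ _ a c.+1 b xpredT) //.
rewrite mulr_sumr (@telescope_sumr_eq _ a c.+1 (fun v => x ^+ (v + s) * y ^+ (c.+1 - v))) //.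
  by rewrite subnn expr0 mulr1 mulrC [X in _ - X]mulrC mulrC.
move=> v /andP[_ vc]; rewrite ltnS in vc.
by rewrite subSS subSn // addSn !exprS; ring.
Qed.

(** Subtract from each column the multiple of the next one that kills the last
    entry; the matrix [U] below performs this.  What remains of the other rows is
    divisible by [x_k - x_max], with quotient given by [geometric_difference]. *)
Lemma alternant_recr (A : comNzRingType) (n b : nat) (lam : 'I_n.+1 -> nat) (x : 'I_n.+1 -> A) :
  partition_shape lam -> (forall k, (lam k < b)%N) ->
  alternant (fun p => lam p + (n - p))%N x =
  (\prod_(k < n) (x (fintype.lift ord_max k) - x ord_max)) * x ord_max ^+ lam ord_max *
  \det (\matrix_(k < n, p < n)
     \sum_(v < b | (lam (fintype.lift ord0 p) <= v)%N && (v <= lam (fintype.lift ord_max p))%N)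
        x (fintype.lift ord_max k) ^+ (v + (n.-1 - p)) *
        x ord_max ^+ (lam (fintype.lift ord_max p) - v)).
Proof.
move=> part lamb; set wid := fintype.lift ord_max.
have widE (k : 'I_n) : wid k = k :> nat by rewrite /= /bump (leqNgt n) ltn_ord.
pose y := x ord_max.
pose c (p : 'I_n) := y ^+ ((lam (wid p)).+1 - lam (fintype.lift ord0 p)).
pose U : 'M[A]_n.+1 := \matrix_(q, p)
  ((q == p)%:R - if unlift ord_max p is Some p0 then (q == fintype.lift ord0 p0)%:R * c p0 else 0).
have detU : \det U = 1.
  rewrite det_trig.
    rewrite big1 // => p _; rewrite mxE eqxx; case: unliftP => [p0|] e; last by rewrite subr0.
    rewrite e (_ : (_ == _) = false) ?mul0r ?subr0 //.
    by apply/eqP => /(congr1 val) /=; rewrite /bump (leqNgt n) ltn_ord /= add0n add1n => /n_Sn.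
  apply/is_trig_mxP => q p lt; rewrite mxE.
  have -> : (q == p) = false by apply/negbTE; rewrite neq_ltn lt.
  case: unliftP => [p0|] e; last by rewrite subr0.
  rewrite (_ : (_ == _) = false) ?mul0r ?subr0 //.
  apply/eqP => e2; move: lt; rewrite e e2 lift0 -/wid widE.
  by rewrite ltnNge leqnSn.
pose N := (\matrix_(k < n.+1, p < n.+1) x k ^+ (lam p + (n - p))) *m U.
have NE k p : N k p = x k ^+ (lam p + (n - p)) -
   (if unlift ord_max p is Some p0 then c p0 * x k ^+ (lam (fintype.lift ord0 p0) + (n.-1 - p0)) else 0).
  rewrite mxE (eq_bigr (fun q => x k ^+ (lam q + (n - q)) * (q == p)%:R -
     x k ^+ (lam q + (n - q)) * if unlift ord_max p is Some p0 then
       (q == fintype.lift ord0 p0)%:R * c p0 else 0)) => [|q _]; last first.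
    by rewrite !mxE mulrBr.
  rewrite sumrB (bigD1 p) //= eqxx mulr1 [X in _ + X - _]big1 => [|q /negbTE->]; last by rewrite mulr0.
  rewrite addr0; congr (_ - _); case: unliftP => [p0|] e; last by rewrite big1 // => q; rewrite mulr0.
  rewrite (bigD1 (fintype.lift ord0 p0)) //= eqxx mul1r [X in _ + X]big1 => [|q /negbTE->]; last first.
    by rewrite mul0r mulr0.
  rewrite addr0 mulrC; congr (_ * _ ^+ (_ + _)).
  by rewrite /bump /= add1n subnS -subn1 subnAC subn1.
have -> : alternant (fun p : 'I_n.+1 => lam p + (n - p))%N x = \det N.
  by rewrite det_mulmx detU mulr1.
rewrite (expand_det_row _ ord_max) (bigD1 ord_max) //= big1 => [|p nep]; last first.
  rewrite NE; case: unliftP nep => [p0 e _|->]; last by rewrite eqxx.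
  have le : (lam (fintype.lift ord0 p0) <= lam (wid p0))%N by apply: part; rewrite widE lift0.
  rewrite -/y /c -exprD e -/wid widE.
  have E : ((lam (wid p0)).+1 - lam (fintype.lift ord0 p0) + (lam (fintype.lift ord0 p0) +
      (n.-1 - p0)) = lam (wid p0) + (n - p0))%N by have := ltn_ord p0; lia.
  by rewrite E subrr mul0r.
rewrite addr0.
rewrite NE unlift_none subr0 subnn addn0 /cofactor.
rewrite -signr_odd addnn odd_double expr0 mul1r -/y.
pose d : 'rV[A]_n := \row_k (x (wid k) - y).
have -> : \prod_(k < n) (x (wid k) - y) = \det (diag_mx d).
  by rewrite det_diag; apply: eq_bigr => k _; rewrite mxE.
rewrite -mulrA [RHS]mulrCA -det_mulmx; congr (_ * \det _); apply/matrixP => k p.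
transitivity (N (wid k) (wid p)); first by rewrite 2![LHS]mxE.
rewrite NE liftK mul_diag_mx !mxE geometric_difference; first last.
- exact: lamb.
- by apply: leqW; apply: part; rewrite widE lift0.
rewrite -/(c p); congr (_ ^+ _ - _).
have -> : (n - wid p = (n.-1 - p).+1)%N
  by rewrite widE -subn1 subnAC subn1 prednK // subn_gt0; apply: ltn_ord.
by rewrite addnS addSn.
Qed.

(** Both sides satisfy the same recursion in the number of variables: expanding the
    sums in [alternant_recr] column by column gives the interlaced shapes of
    [schur_branching].  No division is involved, so any commutative ring will do. *)
Lemma bialternant (A : comNzRingType) (n : nat) (lam : 'I_n -> nat) (x : 'I_n -> A) :
  partition_shape lam ->
  schur_eval lam x * diff_product x = alternant (fun p => lam p + (n.-1 - p))%N x.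
Proof.
elim: n lam x => [|n IH] lam x part.
  rewrite /alternant det_mx00 /diff_product big_ord0 mulr1 /schur_eval.
  have T0 : {ffun cell lam -> 'I_0} by apply: finfun => -[[]].
  have Tu (T : {ffun cell lam -> 'I_0}) : T = T0 by apply/ffunP => -[[]].
  rewrite (big_pred1 T0) => [|T]; first by rewrite big1 // => -[[]].
  by rewrite (Tu T) [RHS]eqxx; apply/semistandardP; split => -[].
pose b := (lam ord0).+1.
have lamb k : (lam k < b)%N by rewrite ltnS; apply: part.
have widE (k : 'I_n) : fintype.lift ord_max k = k :> nat.
  by rewrite /= /bump (leqNgt n) ltn_ord.
rewrite /= (alternant_recr x part lamb) det_sum_cols (schur_branching part x lamb).
rewrite diff_product_recr mulr_suml [RHS]mulr_sumr; apply: eq_big => [f|f int].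
  by rewrite /interlaced; apply: eq_forallb => p; rewrite andbC.
have partf : partition_shape (fun k => f k : nat).
  move=> p q; rewrite leq_eqVlt => /orP[/eqP/val_inj->//|lt].
  have /forallP int' := int.
  have /andP[h _] := int' q; have /andP[_ h'] := int' p.
  apply: leq_trans h _; apply: leq_trans h'; apply: part.
  by rewrite lift0 widE.
set X := \prod_(k < n) (_ - _); set Y := x ord_max ^+ _; set Z := diff_product _.
set D := \prod_(k < n) _ ^+ _; set S := schur_eval _ _.
transitivity (X * Y * (D * (S * Z))); first by ring.
rewrite IH //; congr (_ * _).
pose d : 'rV[A]_n := \row_p (x ord_max ^+ (lam (fintype.lift ord_max p) - f p)).
have -> : D = \det (diag_mx d) by rewrite det_diag; apply: eq_bigr => k _; rewrite mxE.
rewrite mulrC -det_mulmx; congr (\det _); apply/matrixP => k p.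
by rewrite mul_mx_diag !mxE.
Qed.

(** * Positive roots of polynomials with few terms *)

(** Rolle's theorem between consecutive roots; the new roots of the derivative are
    distinct from the given roots, so that double roots can still be added to them. *)
Lemma rolle_seq (R : rcfType) (f : {poly R}) (zs : seq R) :
  uniq zs -> all (fun z => 0 < z) zs -> all (root f) zs ->
  exists ys, [/\ uniq ys, size ys = (size zs).-1, all (fun y => 0 < y) ys,
                 all (root f^`()) ys & {in ys, forall y, y \notin zs}].
Proof.
suff main z s : path <%R z s -> all (root f) (z :: s) ->
    exists ys, [/\ uniq ys, size ys = size s, all (root f^`()) ys &
                   {in ys, forall y, (z < y) && (y \notin z :: s)}].
  move=> uz pz rz; have ss := sort_sorted (@le_total _ R) zs.
  have st : sorted <%R (sort <=%R zs) by rewrite lt_sorted_uniq_le sort_uniq uz.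
  rewrite -(size_sort <=%R).
  have rs : all (root f) (sort <=%R zs) by rewrite all_sort.
  have ps : all (fun z => 0 < z) (sort <=%R zs) by rewrite all_sort.
  case E : (sort <=%R zs) st rs ps => [|z s] st rs ps.
    by exists [::]; split.
  have [ys [u sz r h]] := main z s st rs.
  exists ys; split => //.
    apply/allP => y /h /andP[zy _]; apply: lt_trans zy.
    by case/andP: ps.
  by move=> y /h /andP[_]; rewrite -E mem_sort.
elim: s z => [|z1 s IH] z; first by exists [::].
rewrite /= => /andP[lt p] /and3P[rz r1 rs].
have [||ys [u sz r h]] := IH z1; rewrite ?p /= ?r1 ?rs //.
have [c cin cr] := @rolle _ z z1 f lt (etrans (rootP rz) (esym (rootP r1))).
move: cin; rewrite in_itv /= => /andP[zc cz1].
exists (c :: ys); split => //=.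
- by rewrite u andbT; apply/negP => /h /andP[h1 _]; move: (lt_trans cz1 h1); rewrite ltxx.
- by rewrite sz.
- by rewrite r andbT; apply/rootP.
move=> y; rewrite inE => /predU1P[->|/h /andP[h1 h2]].
  rewrite zc !inE (gt_eqF zc) (lt_eqF cz1) /=.
  apply/negP => /(allP (order_path_min lt_trans p)) h'.
  by move: (lt_trans cz1 h'); rewrite ltxx.
by rewrite (lt_trans lt h1) inE negb_or h2 andbT gt_eqF // (lt_trans lt h1).
Qed.

(** A weak form of Descartes' rule of signs, with roots [zs], of which those in [ds]
    are multiple.  Powers of X split off without affecting positive roots, and
    when the constant term is nonzero, differentiation loses one term and, by
    Rolle, at most one root. *)
Lemma fewnomial_eq0 (R : rcfType) (f : {poly R}) (ms : seq nat) (zs ds : seq R) :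
  (forall i, f`_i != 0 -> i \in ms) ->
  uniq zs -> all (fun z => 0 < z) zs -> all (root f) zs ->
  uniq ds -> {subset ds <= zs} -> all (root f^`()) ds ->
  (size ms <= size zs + size ds)%N -> f = 0.
Proof.
have [k] := ubnP (size f); elim: k f ms zs ds => // k IH f ms zs ds.
rewrite ltnS => szf supp uz pz rz ud dz rd le.
have [f0|fn0] := eqVneq f 0; first by [].
pose ms' := [seq m.-1 | m <- ms & m != 0%N].
have le' : (size ms' <= size ms)%N by rewrite size_map size_filter count_size.
have [c0|c0] := eqVneq f`_0 0.
  have /factor_theorem [g fE] : root f 0 by rewrite /root horner_coef0 c0.
  rewrite subr0 in fE; have gn0 : g != 0 by apply: contra_neq fn0; rewrite fE => ->; rewrite mul0r.
  have gz z : z \in zs -> root g z.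
    move=> zin; move/allP: rz => /(_ _ zin); rewrite fE rootM rootX => /orP[//|/eqP z0].
    by move/allP: pz => /(_ _ zin); rewrite z0 ltxx.
  rewrite fE (IH g ms' zs ds) ?mul0r //.
  - by rewrite fE size_mulX // in szf.
  - move=> i gi; apply/mapP; exists i.+1 => //; rewrite mem_filter /=.
    by apply: supp; rewrite fE coefMX.
  - by apply/allP.
  - apply/allP => d din; move/allP: rd => /(_ _ din).
    rewrite fE derivM derivX mulr1 /root hornerD hornerM hornerX.
    rewrite (rootP (gz d (dz d din))) addr0 mulf_eq0 => /orP[//|/eqP d0].
    by move/allP: pz => /(_ _ (dz d din)); rewrite d0 ltxx.
  - exact: leq_trans le' le.
have [ys [uy sy py ry yz]] := rolle_seq uz pz rz.
have m0 : 0%N \in ms by apply: supp.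
have lt' : (size ms' < size ms)%N.
  rewrite size_map size_filter ltn_neqAle count_size andbT -all_count.
  by apply/negP => /allP /(_ _ m0).
have zn0 : (0 < size zs)%N.
  case: (zs) dz le => [|//] dz; case: (ds) dz => [|d s] dz /=.
    by case: (ms) m0.
  by have := dz d (mem_head _ _).
suff f'0 : f^`() = 0.
  case: (zs) zn0 rz => // z s _ /= /andP[rz _].
  have /size1_polyC fC : (size f <= 1)%N.
    rewrite leqNgt; apply/negP => sf.
    have : f^`()`_((size f).-2) != 0.
      rewrite coef_deriv -subn2 -subSn // subn2 /= mulrn_eq0 negb_or.
      rewrite -lead_coefE lead_coef_eq0 fn0 andbT -lt0n.
      by case: (size f) sf => [|[]].
    by rewrite f'0 coef0 eqxx.
  by move: rz; rewrite fC rootC => /eqP->.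
apply: (IH _ ms' (ys ++ ds) [::]) => //.
- by apply: leq_trans (lt_size_deriv fn0) _.
- move=> i; rewrite coef_deriv => gi; apply/mapP; exists i.+1 => //; rewrite mem_filter /=.
  by apply: supp; apply: contra_neq gi => ->; rewrite mul0rn.
- rewrite cat_uniq uy ud /= andbT; apply/hasPn => d /dz dzs; apply/negP => /yz.
  by rewrite dzs.
- by rewrite all_cat py; apply/allP => d /dz /(allP pz).
- by rewrite all_cat ry rd.
by rewrite size_cat sy /= addn0; lia.
Qed.

(** * Power vectors modulo an irreducible polynomial *)

Definition is_derivation (R : comNzRingType) (D : R -> R) : Prop :=
  (forall x y, D (x + y) = D x + D y) /\ (forall x y, D (x * y) = D x * y + x * D y).

Section Derivation.
Variables (R : comNzRingType) (D : R -> R).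
Hypothesis derD : is_derivation D.

Lemma derivation0 : D 0 = 0.
Proof. by apply: (addrI (D 0)); rewrite -derD.1 !addr0. Qed.

Lemma derivation1 : D 1 = 0.
Proof. by apply: (addrI (D 1)); rewrite addr0 -[in RHS](mulr1 1) derD.2 mulr1 mul1r. Qed.

Lemma derivation_sum (I : Type) (s : seq I) (F : I -> R) :
  D (\sum_(i <- s) F i) = \sum_(i <- s) D (F i).
Proof. exact: (big_morph D derD.1 derivation0). Qed.

Lemma derivation_exp x k : D (x ^+ k) = x ^+ k.-1 *+ k * D x.
Proof.
elim: k => [|k IH]; first by rewrite expr0 derivation1 mulr0n mul0r.
rewrite exprS derD.2 IH; case: k {IH} => [|k] /=; first by rewrite expr0 mulr0n mul0r mulr0 addr0 mulr1 mul1r.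
by rewrite [in RHS]mulrSr mulrDl addrC [D x * _]mulrC mulrA mulrnAr -exprS.
Qed.

Lemma map_poly_derivation : is_derivation (map_poly D).
Proof.
split=> p q; apply/polyP => i.
  by rewrite coefD !coef_map_id0 ?derivation0 // coefD derD.1.
rewrite coefD !coefM coef_map_id0 ?derivation0 // coefM derivation_sum -big_split /=.
by apply: eq_bigr => j _; rewrite derD.2 !coef_map_id0 ?derivation0.
Qed.

(** On the curve [p = 0] the derivation [D] extends by [X |-> - D p / p']; this is
    [p'] times that extension.  It kills [p], hence preserves the ideal of [p]. *)
Definition curve_derivation (p h : {poly R}) : {poly R} :=
  p^`() * map_poly D h - map_poly D p * h^`().

Lemma curve_derivationP p : is_derivation (curve_derivation p).
Proof.
have [dD dM] := map_poly_derivation; rewrite /curve_derivation.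
by split=> x y; rewrite ?dD ?dM ?derivD ?derivM; ring.
Qed.

Lemma curve_derivation_self p : curve_derivation p p = 0.
Proof. by rewrite /curve_derivation mulrC subrr. Qed.

Lemma curve_derivationC p c : curve_derivation p c%:P = p^`() * (D c)%:P.
Proof. rewrite /curve_derivation derivC mulr0 subr0; congr (_ * _); apply/polyP => i.
by rewrite coef_map_id0 ?derivation0 // !coefC; case: (i == 0%N); rewrite ?derivation0. Qed.

Lemma curve_derivationX p : curve_derivation p 'X = - map_poly D p.
Proof.
rewrite /curve_derivation derivX mulr1 (_ : map_poly D 'X = 0) ?mulr0 ?sub0r //.
apply/polyP => i; rewrite coef_map_id0 ?derivation0 // coefX coef0.
by case: (_ == _); rewrite ?derivation1 ?derivation0.
Qed.

End Derivation.

Section NodeMatrix.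
Variables (A : comNzRingType) (m : nat) (k0 : 'I_m.+1) (mu : 'I_m.+2 -> nat).

Definition power_row (v : A) (c : 'I_m.+2) : A := v ^+ mu c.
Definition dpower_row (v : A) (c : 'I_m.+2) : A := v ^+ (mu c).-1 *+ mu c.

(** Rows: [y], then the power vectors of the [t_j], with the row [z] inserted at
    position [k0] among them. *)
Definition node_mx (t : 'I_m -> A) (y z : 'I_m.+2 -> A) : 'M[A]_m.+2 :=
  \matrix_(i, c) if unlift ord0 i is Some k then
                   if unlift k0 k is Some j then power_row (t j) c else z c
                 else y c.

(** Expanding along the row [z] makes the determinant a linear form in [z]; these are
    its coefficients.  With [z] the power vector of a variable it is a polynomial
    with [m + 2] terms, vanishing at all the [t_j]. *)
Definition node_cof (t : 'I_m -> A) (y : 'I_m.+2 -> A) (c : 'I_m.+2) : A :=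
  cofactor (node_mx t y (fun=> 0)) (fintype.lift ord0 k0) c.

Lemma node_detE t y z : \det (node_mx t y z) = \sum_c node_cof t y c * z c.
Proof.
rewrite (expand_det_row _ (fintype.lift ord0 k0)); apply: eq_bigr => c _.
rewrite [node_mx _ _ _ _ _]mxE liftK unlift_none mulrC; congr (_ * _).
rewrite /node_cof /cofactor; congr (_ * \det _); apply/matrixP => a b; rewrite !mxE.
case: (unliftP ord0 (fintype.lift (fintype.lift ord0 k0) a)) => [k|] // e.
case: (unliftP k0 k) => [j|] // e2.
by move: (neq_lift (fintype.lift ord0 k0) a); rewrite e e2 eqxx.
Qed.

Definition fewnomial (x : 'I_m.+2 -> A) : {poly A} := \sum_c x c *: 'X^(mu c).

Lemma fewnomial_horner x v : (fewnomial x).[v] = \sum_c x c * power_row v c.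
Proof. by rewrite horner_sum; apply: eq_bigr => c _; rewrite hornerZ hornerXn. Qed.

Lemma fewnomial_deriv_horner x v : (fewnomial x)^`().[v] = \sum_c x c * dpower_row v c.
Proof.
rewrite raddf_sum horner_sum; apply: eq_bigr => c _ /=.
by rewrite derivZ derivXn hornerZ hornerMn hornerXn.
Qed.

Lemma node_det_rows t y z (i1 i2 : 'I_m.+2) : i1 != i2 ->
  (forall c, node_mx t y z i1 c = node_mx t y z i2 c) -> \det (node_mx t y z) = 0.
Proof. by move=> ne h; apply: (determinant_alternate ne). Qed.

Lemma fewnomial_node t y j : (fewnomial (node_cof t y)).[t j] = 0.
Proof.
rewrite fewnomial_horner -node_detE.
apply: (@node_det_rows t y _ (fintype.lift ord0 k0) (fintype.lift ord0 (fintype.lift k0 j))).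
  by rewrite (inj_eq lift_inj) neq_lift.
by move=> c; rewrite !mxE !liftK unlift_none.
Qed.

Lemma fewnomial_dnode t v : (fewnomial (node_cof t (dpower_row v)))^`().[v] = 0.
Proof.
rewrite fewnomial_deriv_horner -node_detE.
apply: (@node_det_rows t _ _ ord0 (fintype.lift ord0 k0)) => // c.
by rewrite !mxE liftK !unlift_none.
Qed.

End NodeMatrix.

Lemma map_node_mx (A B : comNzRingType) (g : {rmorphism A -> B}) (m : nat) (k0 : 'I_m.+1)
    (mu : 'I_m.+2 -> nat) t y z :
  map_mx g (node_mx k0 mu t y z) = node_mx k0 mu (g \o t) (g \o y) (g \o z).
Proof.
apply/matrixP => i c; rewrite !mxE; case: unliftP => // k _; case: unliftP => // j _.
by rewrite /power_row rmorphXn.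
Qed.

Section Key.
Variables (R : idomainType) (m : nat) (k0 : 'I_m.+1) (mu : 'I_m.+2 -> nat) (t : 'I_m -> R).
Variable D : 'I_m -> R -> R.
Hypothesis charR : forall n, n.+1%:R != 0 :> R.
Hypothesis derD : forall j, is_derivation (D j).
Hypothesis Dt : forall j l, D j (t l) = (j == l)%:R.
Hypothesis t_neq0 : forall j, t j != 0.
Hypothesis mu_last : mu ord_max = 0%N.
Variable y0 : 'I_m.+2 -> R.
Hypothesis y0_gen : exists z, \det (node_mx k0 mu t y0 z) != 0.
Hypothesis y0_dnode : forall j, \det (node_mx k0 mu t y0 (dpower_row mu (t j))) != 0.
Hypothesis dnode2 : forall j l, j != l ->
  \det (node_mx k0 mu t (dpower_row mu (t l)) (dpower_row mu (t j))) != 0.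

Definition node_var (k : 'I_m.+1) : {poly R} :=
  if unlift k0 k is Some j then (t j)%:P else 'X.

Definition minor (i : 'I_m.+2) : {poly R} :=
  alternant (fun c => mu (fintype.lift i c)) node_var.

Let N (y : 'I_m.+2 -> R) := node_mx k0 mu (polyC \o t) (polyC \o y) (power_row mu 'X).
Let f (y : 'I_m.+2 -> R) := fewnomial mu (node_cof k0 mu t y).

Lemma node_cof_map y c : node_cof k0 mu (polyC \o t) (polyC \o y) c = (node_cof k0 mu t y c)%:P.
Proof.
rewrite /node_cof -cofactor_map_mx map_node_mx; congr (cofactor _ _ _).
Qed.

Lemma det_node_generic y : \det (N y) = f y.
Proof.
rewrite /N node_detE; apply: eq_bigr => c _.
by rewrite node_cof_map mul_polyC.
Qed.

Lemma cofactor_minor y i : cofactor (N y) ord0 i = (-1) ^+ i * minor i.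
Proof.
rewrite /cofactor add0n; congr (_ * \det _); apply/matrixP => k c.
rewrite !mxE liftK /node_var; case: unliftP => [j|] _ //=.
Qed.

(** Every polynomial of this form is a combination of the maximal minors of the
    matrix with rows [w(t_1), ..., w(t_m), w(X)], so any common factor of the minors
    divides it. *)
Lemma fewnomial_minors y : f y = \sum_i (y i)%:P * ((-1) ^+ i * minor i).
Proof.
rewrite -det_node_generic (expand_det_row _ ord0); apply: eq_bigr => i _.
by rewrite cofactor_minor; congr (_ * _); rewrite mxE unlift_none.
Qed.

Section Irreducible.
Variable p : {poly R}.
Hypothesis irr : irreducible_poly p.
Hypothesis p_minor : forall i, p %| minor i.

Let p_gt1 : (1 < size p)%N. Proof. exact: irr.1. Qed.

Lemma dvdp_prime g h : p %| g * h -> (p %| g) || (p %| h).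
Proof.
case: (boolP (p %| g)) => //= ng.
by rewrite Gauss_dvdpr // irreducible_poly_coprime.
Qed.

Lemma dvdp_const c : p %| c%:P -> c = 0.
Proof.
move=> h; apply/eqP; apply: contraTT h => c0; apply/negP => /dvdp_leq.
by rewrite polyC_eq0 size_polyC c0 => /(_ isT); rewrite leqNgt p_gt1.
Qed.

Lemma dvdp_deriv_irr : p %| p^`() = false.
Proof.
have pn0 : p != 0 by rewrite -size_poly_gt0 ltnW.
apply/negP => /dvdp_leq h.
have d0 : p^`() != 0.
  apply/eqP => /(congr1 (fun q : {poly R} => q`_(size p).-2)).
  rewrite coef0 coef_deriv -subn2 -subSn // subn2 /=.
  rewrite -lead_coefE -mulr_natr => /eqP; rewrite mulf_eq0 lead_coef_eq0 (negbTE pn0) /=.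
  by case: (size p) p_gt1 => [|[|k]] //= _; rewrite (negbTE (charR k)).
by have := leq_trans (lt_size_deriv pn0) (h d0); rewrite ltnn.
Qed.

(** Over a domain [p %| h] only means that a nonzero constant multiple of [h] is a
    multiple of [p]; the constant is differentiated too, which adds a multiple of
    [h]. *)
Lemma dvdp_derivation (E : {poly R} -> {poly R}) h :
  is_derivation E -> E p = 0 -> p %| h -> p %| E h.
Proof.
move=> derE Ep ph; have /Pdiv.Idomain.dvdpP[[c q] /= c0 e] := ph.
have := congr1 E e; rewrite -mul_polyC !derE.2 Ep mulr0 addr0 => e2.
rewrite -(dvdpZr _ _ c0) -mul_polyC.
have -> : c%:P * E h = E q * p - E c%:P * h by rewrite -e2; ring.
by rewrite dvdp_sub ?dvdp_mull.
Qed.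

Lemma dvdp_sum (I : Type) (s : seq I) (P : pred I) (F : I -> {poly R}) :
  (forall i, P i -> p %| F i) -> p %| \sum_(i <- s | P i) F i.
Proof.
move=> h; elim/big_ind: _ => //.
by move=> x y; apply: dvdp_add.
Qed.

Lemma dvdp_fewnomial y : p %| f y.
Proof. by rewrite fewnomial_minors; apply: dvdp_sum => i _; rewrite !dvdp_mull. Qed.

(** Modulo [p] the power vectors of all the nodes are dependent.  The coefficients are
    cofactors of the node matrix along a column [c] chosen such that the
    coefficient [al] of [w(X)], which does not involve X, is nonzero. *)
Lemma power_relation : exists (al : R) (a : 'I_m -> {poly R}), al != 0 /\
  forall c, p %| al%:P * 'X^(mu c) + \sum_j a j * (t j ^+ mu c)%:P.
Proof.
have [z z0] := y0_gen.
have [c c0] : exists c, node_cof k0 mu t y0 c != 0.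
  apply/existsP; apply: contraNT z0; rewrite negb_exists => /forallP h.
  by rewrite node_detE big1 // => c _; move: (h c); rewrite negbK => /eqP->; rewrite mul0r.
exists (node_cof k0 mu t y0 c).
exists (fun j => cofactor (N y0) (fintype.lift ord0 (fintype.lift k0 j)) c); split => // c'.
have E := congr1 (fun M : 'M_m.+2 => M c c') (mul_adj_mx (N y0)).
rewrite /= mxE mxE det_node_generic big_ord_recl (bigD1_ord k0) //= in E.
have -> : (node_cof k0 mu t y0 c)%:P * 'X^(mu c') +
    \sum_j cofactor (N y0) (fintype.lift ord0 (fintype.lift k0 j)) c * (t j ^+ mu c')%:P =
    f y0 *+ (c == c') - cofactor (N y0) ord0 c * (y0 c')%:P.
  rewrite -E !mxE unlift_none [X in X - _]addrC addrK; congr (_ + _).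
    rewrite liftK unlift_none; congr (_ * _).
    rewrite -node_cof_map /node_cof /cofactor; congr (_ * \det _); apply/matrixP => a b; rewrite !mxE.
    case: (unliftP ord0 (fintype.lift (fintype.lift ord0 k0) a)) => [k|] // e.
    case: (unliftP k0 k) => [j|] // e2.
    by move: (neq_lift (fintype.lift ord0 k0) a); rewrite e e2 eqxx.
  by apply: eq_bigr => j _; rewrite !mxE !liftK /power_row /= polyC_exp.
rewrite dvdp_sub //.
  by case: (c == c'); rewrite ?mulr1n ?mulr0n ?dvdp0 ?dvdp_fewnomial.
by rewrite cofactor_minor dvdp_mulr // dvdp_mull.
Qed.

(** Apply the derivation along the curve [p = 0] in the direction [t_j] to the
    relation, then pair with the coefficients [x] of a polynomial [f] vanishing at
    every node.  This annihilates the power vectors of the nodes, and that of X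
    modulo [p]; only the two terms in which a power vector was itself differentiated
    remain, with [f'(X)] and [f'(t_j)]. *)
Lemma differentiated_relation (al : R) (a : 'I_m -> {poly R}) j (x : 'I_m.+2 -> R) :
  (forall c, p %| al%:P * 'X^(mu c) + \sum_l a l * (t l ^+ mu c)%:P) -> al != 0 ->
  (forall l, (fewnomial mu x).[t l] = 0) ->
  p %| al%:P * map_poly (D j) p * (fewnomial mu x)^`()
       - a j * p^`() * ((fewnomial mu x)^`().[t j])%:P.
Proof.
move=> rel al0 xt; set g := fewnomial mu x.
have sumt (b : 'I_m -> {poly R}) :
    \sum_c (x c)%:P * (\sum_l b l * (t l ^+ mu c)%:P) = 0.
  under eq_bigr => c _ do rewrite mulr_sumr.
  rewrite exchange_big big1 //= => l _.
  rewrite -[RHS](mulr0 (b l)) -[in RHS]polyC0 -(xt l) fewnomial_horner rmorph_sum mulr_sumr.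
  by apply: eq_bigr => c _; rewrite rmorphM mulrCA.
have pg : p %| g.
  rewrite -(dvdpZr _ _ al0) -mul_polyC -[X in p %| X]addr0 -(sumt a).
  rewrite /g /fewnomial mulr_sumr -big_split /=; apply: dvdp_sum => c _.
  rewrite -mul_polyC mulrCA -mulrDr; exact: dvdp_mull.
have derE := curve_derivationP (derD j) p; set E := curve_derivation _ p in derE.
have Ep : E p = 0 by exact: curve_derivation_self.
have drel c : p %| E (al%:P * 'X^(mu c) + \sum_l a l * (t l ^+ mu c)%:P).
  exact: dvdp_derivation.
have : p %| \sum_c (x c)%:P * E (al%:P * 'X^(mu c) + \sum_l a l * (t l ^+ mu c)%:P).
  by apply: dvdp_sum => c _; apply: dvdp_mull.
have -> : \sum_c (x c)%:P * E (al%:P * 'X^(mu c) + \sum_l a l * (t l ^+ mu c)%:P) =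
   E al%:P * g - (al%:P * map_poly (D j) p * g^`() - a j * p^`() * (g^`().[t j])%:P).
  rewrite (eq_bigr (fun c => E al%:P * (x c *: 'X^(mu c)) -
     al%:P * map_poly (D j) p * (x c *: 'X^(mu c))^`() +
     (x c)%:P * \sum_l E (a l) * (t l ^+ mu c)%:P +
     a j * p^`() * (x c * dpower_row mu (t j) c)%:P)).
    rewrite !big_split /= sumt addr0 sumrN -!mulr_sumr -raddf_sum -/(fewnomial mu x) -/g.
    by rewrite -rmorph_sum -fewnomial_deriv_horner -/g; ring.
  move=> c _; rewrite derE.1 derE.2 (derivation_sum derE) (derivation_exp derE).
  rewrite [E 'X]curve_derivationX //.
  under eq_bigr => l _ do rewrite derE.2.
  rewrite big_split /= [X in _ + (_ + X)](_ : _ = a j * p^`() * (dpower_row mu (t j) c)%:P).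
    rewrite derivZ derivXn -!mul_polyC rmorphM /=; move: (\sum_l _) => S.
    by rewrite ?mulrnAr; ring.
  rewrite (bigD1 j) //= big1 => [|l nel]; rewrite [E (_%:P)]curve_derivationC //.
    rewrite (derivation_exp (derD j)) Dt eqxx mulr1 addr0 /dpower_row; ring.
  by rewrite (derivation_exp (derD j)) Dt eq_sym (negbTE nel) !mulr0.
by rewrite dvdp_subr // dvdp_mull.
Qed.

(** If [a_l] is nonzero modulo [p], then [p] really depends on [t_l]: otherwise the
    differentiated relation in direction [t_l], paired with the [f] from [y0], would
    give [a_l f'(t_l) = 0] with [f'(t_l)] a nonzero constant.  Now pair with the [f]
    that has a double root at [t_l]: direction [t_l] gives [f'(X) = 0] modulo [p],
    and then direction [t_j] gives [a_j = 0]. *)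
Lemma relation_pair (al : R) (a : 'I_m -> {poly R}) j l :
  (forall c, p %| al%:P * 'X^(mu c) + \sum_l a l * (t l ^+ mu c)%:P) -> al != 0 ->
  j != l -> (p %| a j) || (p %| a l).
Proof.
move=> rel al0 nejl; case: (boolP (p %| a l)) => [_|nal]; first by rewrite orbT.
rewrite orbF.
have Dl : ~~ (p %| map_poly (D l) p).
  apply: contra nal => pD.
  have := differentiated_relation l rel al0 (fewnomial_node k0 mu t y0).
  rewrite dvdp_subr; last by rewrite dvdp_mulr // dvdp_mull.
  case/dvdp_prime/orP => [/dvdp_prime/orP[//|]|/dvdp_const]; first by rewrite dvdp_deriv_irr.
  rewrite fewnomial_deriv_horner -node_detE => /eqP.
  by rewrite (negbTE (y0_dnode l)).
pose y := dpower_row mu (t l).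
have := differentiated_relation l rel al0 (fewnomial_node k0 mu t y).
rewrite fewnomial_dnode polyC0 mulr0 subr0 => /dvdp_prime/orP[/dvdp_prime/orP[|]|pf].
- by move=> /dvdp_const al1; rewrite al1 eqxx in al0.
- by rewrite (negbTE Dl).
have := differentiated_relation j rel al0 (fewnomial_node k0 mu t y).
rewrite dvdp_subr; last by rewrite dvdp_mull.
case/dvdp_prime/orP => [/dvdp_prime/orP[//|]|/dvdp_const]; first by rewrite dvdp_deriv_irr.
rewrite fewnomial_deriv_horner -node_detE => /eqP.
by rewrite (negbTE (dnode2 nejl)).
Qed.

(** By [relation_pair] at most one [a_j] is nonzero modulo [p], and one is because [al]
    is.  The last component, where all powers are 1, gives [al = - a_j]. *)
Lemma powers_congruent : exists j, forall c, p %| 'X^(mu c) - (t j ^+ mu c)%:P.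
Proof.
have [al [a [al0 rel]]] := power_relation.
have alp : ~~ (p %| al%:P) by apply/negP => /dvdp_const al1; rewrite al1 eqxx in al0.
have [/existsP[j nj]|] := boolP [exists j, ~~ (p %| a j)]; last first.
  rewrite negb_exists => /forallP h; have := rel ord_max.
  rewrite mu_last expr0 mulr1 dvdp_addl ?(negbTE alp) //.
  by apply: dvdp_sum => l _; rewrite dvdp_mulr //; move: (h l); rewrite negbK.
exists j => c.
have rel' c' : p %| al%:P * 'X^(mu c') + a j * (t j ^+ mu c')%:P.
  have := rel c'; rewrite (bigD1 j) //= addrA dvdp_addl //.
  apply: dvdp_sum => l nel; rewrite dvdp_mulr //.
  have /orP[//|h] := relation_pair rel al0 nel; by rewrite h in nj.
have := rel' ord_max; rewrite mu_last !expr0 !mulr1 => h0.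
have : p %| al%:P * ('X^(mu c) - (t j ^+ mu c)%:P).
  have -> : al%:P * ('X^(mu c) - (t j ^+ mu c)%:P) =
      (al%:P * 'X^(mu c) + a j * (t j ^+ mu c)%:P) - (al%:P + a j) * (t j ^+ mu c)%:P by ring.
  by rewrite dvdp_sub // dvdp_mulr.
by case/dvdp_prime/orP => //; rewrite (negbTE alp).
Qed.

(** The nonzero constant [t_j] can be cancelled modulo [p], so the exponents of the
    congruences are closed under subtraction and, by Bezout, under gcd. *)
Lemma gcd_congruent j a b : (0 < a)%N -> p %| 'X^a - (t j ^+ a)%:P -> p %| 'X^b - (t j ^+ b)%:P ->
  p %| 'X^(gcdn a b) - (t j ^+ gcdn a b)%:P.
Proof.
move=> a0 ha hb; case: (egcdnP b a0) => u v e _.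
have pw k l : p %| 'X^k - (t j ^+ k)%:P -> p %| 'X^(l * k) - (t j ^+ (l * k))%:P.
  move=> h; rewrite mulnC !exprM polyC_exp subrXX.
exact: dvdp_mulr.
have hua := pw _ u ha; have hvb := pw _ v hb; rewrite e in hua.
have : p %| (t j ^+ (v * b))%:P * ('X^(gcdn a b) - (t j ^+ gcdn a b)%:P).
  have -> : (t j ^+ (v * b))%:P * ('X^(gcdn a b) - (t j ^+ gcdn a b)%:P) =
    ('X^(v * b + gcdn a b) - (t j ^+ (v * b + gcdn a b))%:P) -
    ('X^(v * b) - (t j ^+ (v * b))%:P) * 'X^(gcdn a b).
    by rewrite !exprD rmorphM /=; ring.
  by rewrite dvdp_sub // dvdp_mulr.
case/dvdp_prime/orP => // /dvdp_const /eqP.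
by rewrite expf_eq0 (negbTE (t_neq0 j)) andbF.
Qed.

Lemma sub_congruent j a b : (b <= a)%N -> p %| 'X^a - (t j ^+ a)%:P -> p %| 'X^b - (t j ^+ b)%:P ->
  p %| 'X^(a - b) - (t j ^+ (a - b))%:P.
Proof.
move=> le ha hb.
have : p %| (t j ^+ b)%:P * ('X^(a - b) - (t j ^+ (a - b))%:P).
  have -> : (t j ^+ b)%:P * ('X^(a - b) - (t j ^+ (a - b))%:P) =
    ('X^(b + (a - b)) - (t j ^+ (b + (a - b)))%:P) -
    ('X^b - (t j ^+ b)%:P) * 'X^(a - b).
    by rewrite !exprD rmorphM /=; ring.
  by rewrite subnKC // dvdp_sub // dvdp_mulr.
case/dvdp_prime/orP => // /dvdp_const /eqP.
by rewrite expf_eq0 (negbTE (t_neq0 j)) andbF.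
Qed.

(** If [p^2] divides the minors, it divides the polynomial [f] attached to [y0], so [p]
    divides [f'].  The congruence replaces [X f'(X)] by [t_j f'(t_j)] modulo [p], a
    constant, which must therefore vanish; but [y0] was chosen such that it does
    not. *)
Lemma minors_squarefree j : (forall c, p %| 'X^(mu c) - (t j ^+ mu c)%:P) ->
  ~ (forall i, p * p %| minor i).
Proof.
move=> cong sq.
have pp : p * p %| f y0.
  rewrite fewnomial_minors.
  have h i : p * p %| (y0 i)%:P * ((-1) ^+ i * minor i) by rewrite !dvdp_mull.
  by elim/big_ind: _ => // x y; apply: dvdp_add.
have pd : p %| (f y0)^`().
  have /Pdiv.Idomain.dvdpP[[c q] /= c0 e] := pp.
  have := congr1 (@deriv R) e; rewrite derivZ !derivM => e2.
  rewrite -(dvdpZr _ _ c0) e2.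
  apply: dvdp_add; first by rewrite mulrA dvdp_mull.
  by apply/dvdp_mull/dvdp_add; [apply: dvdp_mull | apply: dvdp_mulr].
have : p %| (t j * (f y0)^`().[t j])%:P.
  have -> : (t j * (f y0)^`().[t j])%:P = 'X * (f y0)^`() -
     \sum_c (node_cof k0 mu t y0 c *+ mu c) *: ('X^(mu c) - (t j ^+ mu c)%:P).
    rewrite fewnomial_deriv_horner mulr_sumr rmorph_sum raddf_sum /= mulr_sumr -sumrB.
    apply: eq_bigr => c _; rewrite derivZ derivXn.
    rewrite /dpower_row -!mul_polyC; case: (mu c) => [|k] /=.
      by rewrite !mulr0n !mulr0 mul0r subr0 polyC0.
    rewrite !exprS ?(mulrnAl, mulrnAr) !rmorphMn /= !rmorphM /= ?(mulrnAl, mulrnAr); ring.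
  rewrite dvdp_sub // ?dvdp_mull //.
  by apply: dvdp_sum => c _; rewrite -mul_polyC dvdp_mull.
move=> /dvdp_const /eqP; rewrite mulf_eq0 (negbTE (t_neq0 j)) /=.
by rewrite fewnomial_deriv_horner -node_detE (negbTE (y0_dnode j)).
Qed.

End Irreducible.
End Key.

(** * Generic nodes *)

Section Numeric.
Variables (F : rcfType) (m : nat) (k0 : 'I_m.+1) (mu : 'I_m.+2 -> nat).
Hypothesis mu_inj : injective mu.

(* The nodes have to be positive, so they are numbered from 1. *)
Let pt (k : nat) : F := k.+1%:R.
Let t (j : 'I_m) : F := pt j.

Lemma pt_inj : injective pt.
Proof. by move=> a b /eqP; rewrite /pt eqr_nat => /eqP[]. Qed.

Lemma coef_fewnomial (x : 'I_m.+2 -> F) c : (fewnomial mu x)`_(mu c) = x c.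
Proof.
rewrite coef_sum (bigD1 c) //= coefZ coefXn eqxx mulr1 big1 ?addr0 // => c' ne.
by rewrite coefZ coefXn (inj_eq mu_inj) eq_sym (negbTE ne) mulr0.
Qed.

(** A vector in the kernel is the coefficient vector of a polynomial with [m + 2]
    terms.  It vanishes at the [m] nodes 1, ..., m, and the rows [y] and [z] are
    assumed to encode two further root conditions: new roots [zs], or multiplicity
    two at nodes [ds]. *)
Lemma det_node_neq0 (y z : 'I_m.+2 -> F) (zs : seq nat) (ds : seq 'I_m) :
  uniq zs -> all (fun k => (m <= k)%N) zs -> uniq ds -> (size zs + size ds = 2)%N ->
  (forall x, \sum_c x c * y c = 0 -> \sum_c x c * z c = 0 ->
     all (root (fewnomial mu x)) (map pt zs) /\
     all (root (fewnomial mu x)^`()) (map t ds)) ->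
  \det (node_mx k0 mu t y z) != 0.
Proof.
move=> uz mz ud sz h; rewrite -det_tr; apply/det0P => -[v vn0 vA].
have rowE i : \sum_c v 0 c * node_mx k0 mu t y z i c = 0.
  by have := congr1 (fun M : 'rV_m.+2 => M 0 i) vA; rewrite !mxE; under eq_bigr do rewrite mxE.
pose f := fewnomial mu (v 0).
have [rz rd] : all (root f) (map pt zs) /\ all (root f^`()) (map t ds).
  apply: h; [have := rowE ord0 | have := rowE (fintype.lift ord0 k0)];
  by under eq_bigr do rewrite mxE ?liftK ?unlift_none ?unlift_none.
have rt j : root f (t j).
  rewrite /root fewnomial_horner; apply/eqP.
  by have := rowE (fintype.lift ord0 (fintype.lift k0 j)); under eq_bigr do rewrite mxE !liftK.
suff f0 : f = 0.
  case/negP: vn0; apply/eqP/rowP => c; rewrite mxE -[LHS](coef_fewnomial (v 0)) -/f f0 coef0 //.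
have ut : uniq [seq t j | j <- enum 'I_m].
  by rewrite map_inj_uniq ?enum_uniq // => a b /pt_inj/val_inj.
apply: (@fewnomial_eq0 F f [seq mu c | c <- enum 'I_m.+2]
   (map pt zs ++ [seq t j | j <- enum 'I_m]) (map t ds)).
- move=> i fi; apply: contraNT fi => ni; rewrite coef_sum big1 // => c _.
  rewrite coefZ coefXn; case: eqP => [e|]; last by rewrite mulr0.
  by case/mapP: ni; exists c; rewrite ?mem_enum.
- rewrite cat_uniq ut andbT (map_inj_uniq pt_inj) uz /=; apply/hasPn => _ /mapP[j _ ->].
  apply/negP => /mapP[k kz /pt_inj e]; move/allP: mz => /(_ _ kz).
  by rewrite -e leqNgt ltn_ord.
- by rewrite all_cat; apply/andP; split; apply/allP => _ /mapP[k _ ->]; rewrite ltr0Sn.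
- by rewrite all_cat rz; apply/allP => _ /mapP[j _ ->].
- by rewrite map_inj_uniq // => a b /pt_inj/val_inj.
- by move=> _ /mapP[j _ ->]; rewrite mem_cat orbC map_f ?mem_enum.
- exact: rd.
by rewrite size_cat 4!size_map !size_enum_ord; lia.
Qed.

Lemma numeric_simple : \det (node_mx k0 mu t (power_row mu (pt m)) (power_row mu (pt m.+1))) != 0.
Proof.
apply: (@det_node_neq0 _ _ [:: m; m.+1] [::]) => //=.
- by rewrite !inE -(inj_eq succn_inj) andbT; apply/eqP; lia.
- by rewrite leqnn leqnSn.
by move=> x hy hz; rewrite !rootE !fewnomial_horner hy hz eqxx.
Qed.

Lemma numeric_double1 j : \det (node_mx k0 mu t (power_row mu (pt m)) (dpower_row mu (t j))) != 0.
Proof.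
apply: (@det_node_neq0 _ _ [:: m] [:: j]) => //=; first by rewrite leqnn.
by move=> x hy hz; rewrite !rootE fewnomial_deriv_horner fewnomial_horner hy hz eqxx.
Qed.

Lemma numeric_double2 j l : j != l ->
  \det (node_mx k0 mu t (dpower_row mu (t l)) (dpower_row mu (t j))) != 0.
Proof.
move=> ne; apply: (@det_node_neq0 _ _ [::] [:: j; l]) => //=; first by rewrite inE ne.
by move=> x hy hz; rewrite !rootE !fewnomial_deriv_horner hy hz eqxx.
Qed.

End Numeric.

Section Generic.
Variables (m : nat) (k0 : 'I_m.+1) (mu : 'I_m.+2 -> nat).
Hypothesis mu_inj : injective mu.
Let R : idomainType := {mpoly rat[m]}.
Let t (j : 'I_m) : R := 'X_j.
(* Once the variables are specialized to 1, ..., m, this is one more node. *)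
Let y0 := power_row mu (m.+1%:R : R).

Let ev : {rmorphism R -> realalg} := mmap (ratr : rat -> realalg) (fun j => j.+1%:R).

Lemma ev_var j : ev (t j) = j.+1%:R.
Proof. by rewrite /= /t mmapX mmap1U. Qed.

Lemma ev_power k c : ev (power_row mu (k%:R : R) c) = power_row mu (k%:R : realalg) c.
Proof. by rewrite /power_row rmorphXn rmorph_nat. Qed.

Lemma ev_dpower j c : ev (dpower_row mu (t j) c) = dpower_row mu (j.+1%:R : realalg) c.
Proof. by rewrite /dpower_row rmorphMn rmorphXn ev_var. Qed.

(** A polynomial identity fails as soon as it fails at the nodes 1, ..., m. *)
Lemma det_node_eval y z y' z' : (forall c, ev (y c) = y' c) -> (forall c, ev (z c) = z' c) ->
  \det (node_mx k0 mu (fun j => j.+1%:R : realalg) y' z') != 0 -> \det (node_mx k0 mu t y z) != 0.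
Proof.
move=> hy hz; apply: contra_neq => d0.
rewrite -(rmorph0 ev) -d0 -det_map_mx map_node_mx; congr (\det _).
apply/matrixP => i c; rewrite !mxE; case: unliftP => [k|] _; last exact/esym/hy.
case: unliftP => [j|] _; last exact/esym/hz.
by rewrite -ev_var.
Qed.

Lemma generic_simple : exists z, \det (node_mx k0 mu t y0 z) != 0.
Proof.
exists (power_row mu (m.+2%:R : R)).
by apply: (det_node_eval _ _ (@numeric_simple realalg m k0 mu mu_inj)) => c; apply: ev_power.
Qed.

Lemma generic_double1 j : \det (node_mx k0 mu t y0 (dpower_row mu (t j))) != 0.
Proof.
apply: (det_node_eval _ _ (@numeric_double1 realalg m k0 mu mu_inj j)) => c; first exact: ev_power.
exact: ev_dpower.
Qed.

Lemma generic_double2 j l : j != l ->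
  \det (node_mx k0 mu t (dpower_row mu (t l)) (dpower_row mu (t j))) != 0.
Proof.
move=> ne; apply: (det_node_eval _ _ (@numeric_double2 realalg m k0 mu mu_inj _ _ ne)) => c;
by apply: ev_dpower.
Qed.

End Generic.

(** * The Betti polynomials have no common factor *)

(** The difference between the last degree of a pure diagram and the [i]-th one. *)
Definition tail_sum (n : nat) (e : 'I_n -> nat) (i : 'I_n.+1) : nat := \sum_(j < n | (i <= j)%N) e j.

Lemma tail_sum_max n (e : 'I_n -> nat) : tail_sum e ord_max = 0%N.
Proof. by apply: big_pred0 => j /=; rewrite leqNgt ltn_ord. Qed.

Lemma tail_sum_step n (e : 'I_n -> nat) (k : 'I_n) :
  tail_sum e (widen_ord (leqnSn n) k) = (e k + tail_sum e (fintype.lift ord0 k))%N.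
Proof.
rewrite /tail_sum (bigD1 k) //=; congr (_ + _)%N; apply: eq_bigl => j.
by rewrite /bump add1n ltn_neqAle -val_eqE /= andbC eq_sym.
Qed.

Lemma tail_sum_anti n (e : 'I_n -> nat) : (forall k, 0 < e k)%N ->
  forall i j : 'I_n.+1, (i < j)%N -> (tail_sum e j < tail_sum e i)%N.
Proof.
move=> e0 i j lt; have lin : (i < n)%N by apply: leq_trans lt _; rewrite -ltnS.
rewrite (_ : i = widen_ord (leqnSn n) (Ordinal lin)); last exact: val_inj.
rewrite tail_sum_step -[X in (X < _)%N]add0n -addSn leq_add // ?e0 //.
rewrite /tail_sum [X in (_ <= X)%N](bigID (fun k : 'I_n => (j <= k)%N)) /=.
apply: leq_trans (leq_addr _ _); apply: eq_leq; apply: eq_bigl => k.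
by rewrite /bump add1n; case: (leqP j k) => h; rewrite ?andbF ?andbT // (leq_trans lt h).
Qed.

Lemma tail_sum_inj n (e : 'I_n -> nat) : (forall k, 0 < e k)%N -> injective (tail_sum e).
Proof.
move=> e0 i j eij; apply: val_inj; case: (ltngtP (val i) (val j)) => // /(tail_sum_anti e0);
by rewrite eij ltnn.
Qed.

Lemma lambda_tail n (e : 'I_n -> nat) (k : 'I_n) : (forall k, 0 < e k)%N ->
  (lambda e k + (n.-1 - k) = tail_sum e (fintype.lift ord0 k))%N.
Proof.
move=> e0; have -> : (n.-1 - k = \sum_(j < n | (k < j)%N) 1)%N.
  rewrite -(big_mkord (fun j => k < j)%N (fun=> 1%N)) big_mkcond.
  rewrite (@big_cat_nat _ _ _ k.+1) //= big_nat big1 ?add0n => [|j /andP[_]].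
    rewrite big_nat (eq_bigr (fun=> 1%N)) => [|j /andP[-> //]].
    by rewrite -big_nat sum_nat_const_nat muln1; lia.
  by rewrite ltnS leqNgt => /negbTE->.
rewrite -big_split /= /tail_sum; apply: eq_big => j; first by rewrite lift0.
by rewrite subnK.
Qed.

(** Adding the staircase to [alpha e i] undoes the shifts [e_j - 1] in its definition,
    and gives all the tail sums except the [i]-th. *)
Lemma alpha_tail n (e : 'I_n -> nat) (i : 'I_n.+1) (k : 'I_n) : (forall k, 0 < e k)%N ->
  (alpha e i k + (n.-1 - k) = tail_sum e (fintype.lift i k))%N.
Proof.
move=> e0; rewrite /alpha addnAC lambda_tail // addnC; case: ltnP => h.
  rewrite -tail_sum_step; congr (tail_sum _ _); apply: val_inj.
  by rewrite /= /bump leqNgt h.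
by rewrite add0n; congr (tail_sum _ _); apply: val_inj; rewrite /= /bump h.
Qed.

Lemma alpha_partition n (e : 'I_n -> nat) (i : 'I_n.+1) : (forall k, 0 < e k)%N ->
  partition_shape (alpha e i).
Proof.
move=> e0 p q; rewrite leq_eqVlt => /orP[/eqP/val_inj->//|lt].
have dl : (lambda e q + (e q - 1) <= lambda e p)%N.
  rewrite /lambda addnC [X in (_ <= X)%N](bigD1 q) //= leq_add2l.
  rewrite [X in (_ <= X)%N](bigID (fun k : 'I_n => (q < k)%N)) /=.
  apply: leq_trans (leq_addr _ _); apply: eq_leq; apply: eq_bigl => k.
  case: (ltnP q k) => h; rewrite ?andbF ?andbT //.
  by rewrite (ltn_trans lt h) -val_eqE /= neq_ltn h orbT.
rewrite /alpha; have := e0 p; have := e0 q; move: dl.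
move: (lambda e p) (lambda e q) (e p) (e q) => a b c d.
move: (nat_of_ord p) (nat_of_ord q) (nat_of_ord i) lt => p' q' i' lt h3 h4 h5.
case: ltnP => h1; case: ltnP => h2; lia.
Qed.

Lemma diff_product_factor (A : comNzRingType) n (x : 'I_n -> A) (a b : 'I_n) :
  a != b -> exists q, diff_product x = (x a - x b) * q.
Proof.
suff main (a' b' : 'I_n) : (a' < b')%N -> exists q, diff_product x = (x a' - x b') * q.
  rewrite -val_eqE neq_ltn => /orP[/main//|/main[q ->]].
  by exists (- q); rewrite mulrN -mulNr opprB.
move=> lt; exists (\prod_(j < n | (a' < j)%N && (j != b')) (x a' - x j) *
  \prod_(i < n | i != a') \prod_(j < n | (i < j)%N) (x i - x j)).
by rewrite /diff_product (bigD1 a') //= (bigD1 b') //= !mulrA.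
Qed.

(** The quotient of [s i0] by its gcd with [b] divides every [s i], so it is constant:
    a nonconstant divisor of minimal size would be irreducible. *)
Lemma coprime_cancel (R : idomainType) (I : finType) (s : I -> {poly R}) (i0 : I) (b : {poly R}) :
  s i0 != 0 -> (forall p, irreducible_poly p -> ~ (forall i, p %| s i)) ->
  (forall i, s i0 %| b * s i) -> s i0 %| b.
Proof.
move=> s0 nop h; set d := gcdp (s i0) b.
have dn0 : d != 0 by rewrite gcdp_eq0 negb_and s0.
set q := s i0 %/ d; set b' := b %/ d.
have cop : coprimep q b' by apply: coprimep_div_gcd; rewrite s0.
have es : q * d = lead_coef d ^+ scalp (s i0) d *: s i0 by apply/Pdiv.Idomain.divpK/dvdp_gcdl.
have eb : b' * d = lead_coef d ^+ scalp b d *: b by apply/Pdiv.Idomain.divpK/dvdp_gcdr.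
have lc k : lead_coef d ^+ k != 0 by rewrite expf_neq0 // lead_coef_eq0.
have qs i : q %| s i.
  rewrite -(Gauss_dvdpr _ cop) -(dvdp_mul2r _ _ dn0) es dvdpZl ?lc //.
  by rewrite mulrAC eb -scalerAl dvdpZr ?lc.
have qn0 : q != 0.
  apply/eqP => q0; have /eqP : lead_coef d ^+ scalp (s i0) d *: s i0 = 0 by rewrite -es q0 mul0r.
  by rewrite -mul_polyC mulf_eq0 polyC_eq0 (negbTE (lc _)) (negbTE s0).
have [sq|sq] := leqP (size q) 1.
  rewrite -(dvdpZl _ _ (lc (scalp (s i0) d))) -es.
  have [c qE] : exists c, q = c%:P by exists q`_0; apply: size1_polyC.
  rewrite qE mul_polyC dvdpZl ?dvdp_gcdr //.
  by apply: contra_neq qn0; rewrite qE => ->.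
(* Against the goal False the descent to an irreducible divisor can proceed *)
(* by contradiction, without deciding irreducibility over the domain R.     *)
suff : False by [].
have [k] := ubnP (size q).
elim: k q {cop es} qs qn0 sq => // k IH q qs qn0 sq; rewrite ltnS => szk.
apply: (nop q) => //; split=> // g sg gq.
have gn0 : g != 0 by apply: contraTneq gq => ->; rewrite dvd0p.
rewrite -dvdp_size_eqp //; case: ltngtP (dvdp_leq qn0 gq) => // lt _.
exfalso; apply: (IH g) => //.
- by move=> i; apply: dvdp_trans gq (qs i).
- by rewrite ltn_neqAle eq_sym sg size_poly_gt0.
- exact: leq_trans lt szk.
Qed.

Section NoCommonFactor.
Variables (m : nat) (e e' : 'I_m.+1 -> nat) (r : nat).
Hypothesis e_gt0 : forall k, (0 < e k)%N.
Hypothesis r_gcd : r = \big[gcdn/0%N]_(k < m.+1) e k.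
Hypothesis e_re' : forall k, e k = (r * e' k)%N.

Lemma e'_gt0 k : (0 < e' k)%N.
Proof. by have := e_gt0 k; rewrite e_re' muln_gt0 => /andP[]. Qed.

Lemma tail_sum_scaled i : tail_sum e i = (r * tail_sum e' i)%N.
Proof. by rewrite /tail_sum big_distrr; apply: eq_bigr => j _. Qed.

(** The bialternant formula at [x^r]: the exponents of the alternant become [r] times
    the tail sums of [e'], which are those of [e]. *)
Lemma schur_minor (A : comNzRingType) (x : 'I_m.+1 -> A) (i : 'I_m.+2) :
  schur_eval (alpha e' i) (fun k => x k ^+ r) * diff_product (fun k => x k ^+ r) =
  alternant (fun p => tail_sum e (fintype.lift i p)) x.
Proof.
rewrite bialternant; last exact/alpha_partition/e'_gt0.
congr (\det _); apply/matrixP => k p; rewrite !mxE alpha_tail; last exact: e'_gt0.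
by rewrite tail_sum_scaled exprM.
Qed.

Variable k0 : 'I_m.+1.
Let R : idomainType := {mpoly rat[m]}.
Let t (j : 'I_m) : R := 'X_j.
Let mu := tail_sum e.

Lemma mderiv_derivation (j : 'I_m) : is_derivation (fun x : R => mderiv j x : R).
Proof. by split=> x y; [exact: mderivD | exact: mderivM]. Qed.

Lemma mderiv_var (j l : 'I_m) : mderiv j ('X_l : R) = (j == l)%:R.
Proof.
rewrite mderivX mnm1E eq_sym; case: eqVneq => [->|ne]; last by rewrite scale0r.
have -> : (U_(l) - U_(l) = 0)%MM by apply/mnmP => i; rewrite mnmBE subnn mnm0E.
by rewrite scale1r mpolyX0.
Qed.

(** The common factor [p] divides [X^r - t_j^r] by the results above, and so does the
    product of differences by which the Schur polynomial was multiplied to give the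
    minor.  Hence [p^2] divides all minors. *)
Lemma schur_no_common_factor (p : {poly R}) : irreducible_poly p ->
  ~ (forall i, p %| schur_eval (alpha e' i) (fun k => node_var k0 t k ^+ r)).
Proof.
move=> irr ps.
have mu_inj : injective mu := tail_sum_inj e_gt0.
have charR l : l.+1%:R != 0 :> R.
  by rewrite -mpolyC_nat mpolyC_eq0 pnatr_eq0.
have tn0 j : t j != 0 by rewrite -msupp_eq0 msuppX.
have mlast0 : mu ord_max = 0%N by exact: tail_sum_max.
have pm i : p %| minor k0 mu t i by rewrite /minor -schur_minor dvdp_mulr.
have y0g := generic_simple k0 mu_inj; have y0d := generic_double1 k0 mu_inj.
have d2 := @generic_double2 _ k0 _ mu_inj.
have [j cong] := powers_congruent charR mderiv_derivation mderiv_var mlast0 y0g y0d d2 irr pm.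
have pr : p %| 'X^r - (t j ^+ r)%:P.
  rewrite r_gcd; elim/big_ind: _ => [|a b ha hb|k _].
  - by rewrite !expr0 subrr dvdp0.
  - case: (posnP a) => [->|a0]; first by rewrite gcd0n.
    exact: gcd_congruent.
  - have := tail_sum_step e k; rewrite -/mu => E.
    have -> : e k = (mu (widen_ord (leqnSn m.+1) k) - mu (fintype.lift ord0 k))%N by rewrite E addnK.
    by apply: sub_congruent => //; rewrite E leq_addl.
apply: (minors_squarefree tn0 y0d irr cong) => i.
rewrite /minor -schur_minor dvdp_mul //.
have [q ->] := @diff_product_factor _ _ (fun k => node_var k0 t k ^+ r) k0 (fintype.lift k0 j) (neq_lift _ _).
by rewrite dvdp_mulr // /node_var unlift_none liftK -polyC_exp.
Qed.

End NoCommonFactor.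

(** * Divisibility up to factors free of a variable *)

Lemma rmorph_mpoly (n : nat) (F A : comNzRingType) (g : {rmorphism {mpoly F[n]} -> A}) (p : {mpoly F[n]}) :
  g p = \sum_(m <- msupp p) g (p@_m)%:MP * \prod_(i < n) g 'X_i ^+ m i.
Proof.
rewrite {1}[p]mpolyE rmorph_sum; apply: eq_bigr => m _.
rewrite -mul_mpolyC rmorphM; congr (_ * _).
by rewrite mpolyXE_id rmorph_prod; apply: eq_bigr => i _; rewrite rmorphXn.
Qed.

Lemma eq_rmorph_mpoly (n : nat) (F A : comNzRingType) (g h : {rmorphism {mpoly F[n]} -> A}) :
  (forall c, g c%:MP = h c%:MP) -> (forall i, g 'X_i = h 'X_i) -> g =1 h.
Proof.
move=> hc hX p; rewrite rmorph_mpoly [RHS]rmorph_mpoly; apply: eq_bigr => m _.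
by rewrite hc; congr (_ * _); apply: eq_bigr => i _; rewrite hX.
Qed.

Section SplitVariable.
Variables (F : fieldType) (m : nat) (k0 : 'I_m.+1).

Definition embed_others : {rmorphism {mpoly F[m]} -> {mpoly F[m.+1]}} :=
  mmap (@mpolyC m.+1 F) (fun j => 'X_(fintype.lift k0 j)).
(** Views the polynomial as a univariate polynomial in the variable [k0] over the ring
    of polynomials in the others; [merge_var] is the inverse. *)
Definition isolate_var (p : {mpoly F[m.+1]}) : {poly {mpoly F[m]}} :=
  mmap (polyC \o @mpolyC m F) (node_var k0 (fun j => 'X_j)) p.
Definition merge_var (h : {poly {mpoly F[m]}}) : {mpoly F[m.+1]} := (map_poly embed_others h).['X_k0].

Lemma merge_isolate_var p : merge_var (isolate_var p) = p.
Proof.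
rewrite -[RHS]/(idfun p).
apply: (@eq_rmorph_mpoly _ _ _ (horner_eval 'X_k0 \o map_poly embed_others \o
  mmap (polyC \o @mpolyC m F) (node_var k0 (fun j => 'X_j))) idfun) => [c|i] /=.
  by rewrite /isolate_var /= mmapC /= map_polyC /horner_eval hornerC /embed_others /= mmapC.
rewrite /isolate_var /= mmapX mmap1U /node_var; case: unliftP => [j|] ->.
  by rewrite map_polyC /horner_eval hornerC /embed_others /= mmapX mmap1U.
by rewrite map_polyX /horner_eval hornerX.
Qed.

Lemma isolate_var_inj : injective isolate_var.
Proof. by move=> p q e; rewrite -[p]merge_isolate_var e merge_isolate_var. Qed.

Lemma embed_others_inj : injective embed_others.
Proof.
pose proj : {rmorphism {mpoly F[m.+1]} -> {mpoly F[m]}} :=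
  mmap (@mpolyC m F) (fun i => if unlift k0 i is Some j then 'X_j else 0).
have K c : proj (embed_others c) = c.
  rewrite -[RHS]/(idfun c); apply: (@eq_rmorph_mpoly _ _ _ (proj \o embed_others) idfun) => [d|j] /=.
    by rewrite /embed_others /= mmapC /proj /= mmapC.
  by rewrite /embed_others /= mmapX mmap1U /proj /= mmapX mmap1U liftK.
by move=> c d e; rewrite -[c]K e K.
Qed.

Lemma mlead_embed_others c : c != 0 -> mlead (embed_others c) k0 = 0%N.
Proof.
move=> c0; have : mlead (embed_others c) \in msupp (embed_others c).
  by apply: mlead_supp; rewrite -(rmorph0 embed_others) (inj_eq embed_others_inj).
rewrite mcoeff_msupp; apply: contraNeq => k0n0.
rewrite {2}[embed_others c]rmorph_mpoly (raddf_sum (mcoeff _)) /= big1 // => mm _.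
have -> : \prod_(i < m) embed_others 'X_i ^+ mm i = 'X_[\sum_(i < m) U_(fintype.lift k0 i) *+ mm i].
  by rewrite -mprodXnE; apply: eq_bigr => i _; rewrite /embed_others /= mmapX mmap1U.
rewrite /embed_others /= mmapC mcoeffCM mcoeffX; case: eqP => [E|]; last by rewrite mulr0.
case/negP: k0n0; rewrite -E mnm_sumE big1 // => i _.
by rewrite mulmnE mnm1E eq_sym (negbTE (neq_lift _ _)).
Qed.

Lemma merge_varM x y : merge_var (x * y) = merge_var x * merge_var y.
Proof. by rewrite /merge_var rmorphM hornerM. Qed.

Lemma merge_varC c : merge_var c%:P = embed_others c.
Proof. by rewrite /merge_var map_polyC hornerC. Qed.

Lemma dvd_merge_var (x y : {poly {mpoly F[m]}}) (s b : {mpoly F[m.+1]}) :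
  merge_var x = s -> merge_var y = b -> x %| y ->
  exists g q, [/\ g != 0, mlead g k0 = 0%N & g * b = q * s].
Proof.
move=> <- <- /Pdiv.Idomain.dvdpP[[c q] /= c0 e].
exists (embed_others c), (merge_var q); split.
- by rewrite -(rmorph0 embed_others) (inj_eq embed_others_inj).
- exact: mlead_embed_others.
by rewrite -merge_varC -!merge_varM mul_polyC; congr merge_var; exact: e.
Qed.

(** Divisibility over the domain of polynomials in the other variables allows a
    multiplier [g] from that domain.  That [g] does not involve the variable [k0] is
    recorded as a condition on its leading monomial, the form in which
    [mpoly_dvd_of_free] needs it. *)
Lemma dvd_isolate_var (s b : {mpoly F[m.+1]}) : isolate_var s %| isolate_var b ->
  exists g q, [/\ g != 0, mlead g k0 = 0%N & g * b = q * s].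
Proof. exact: (dvd_merge_var (merge_isolate_var s) (merge_isolate_var b)). Qed.

End SplitVariable.

(** In [g b = q s] the leading monomial of [g] has exponent 0 at [k], so that of [s] is
    at most that of [b] at [k].  As this holds for all [k], the leading monomial of
    [s] divides that of [b]; subtracting a multiple of [s] from [b] keeps the
    hypotheses and lowers the leading monomial. *)
Lemma mpoly_dvd_of_free (F : fieldType) (n : nat) (s b : {mpoly F[n]}) : s != 0 ->
  (forall k, exists g q, [/\ g != 0, mlead g k = 0%N & g * b = q * s]) ->
  exists c, b = c * s.
Proof.
move=> s0; elim/mleadrect: b => b IH h.
have [->|b0] := eqVneq b 0; first by exists 0; rewrite mul0r.
have le : (mlead s <= mlead b)%MM.
  apply/mnm_lepP => k; have [g [q [g0 gk e]]] := h k.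
  have q0 : q != 0.
    apply/eqP => q0; move/eqP: e; rewrite q0 mul0r mulf_eq0.
    by rewrite (negbTE g0) (negbTE b0).
  have := congr1 (fun p => mlead p k) e; rewrite !mleadM // !mnmDE gk add0n => ->.
  exact: leq_addl.
pose c := (mleadc b / mleadc s) *: 'X_[mlead b - mlead s] : {mpoly F[n]}.
have mls : mleadc s != 0 by rewrite mleadc_eq0.
pose b1 := b - c * s.
have [b10|b1n0] := eqVneq b1 0.
  by exists c; apply/eqP; rewrite -subr_eq0 -/b1 b10.
have c0 : c != 0.
  rewrite /c -mul_mpolyC mulf_neq0 // ?mpolyC_eq0 ?mulf_neq0 ?invr_neq0 ?mleadc_eq0 //.
  by rewrite -msupp_eq0 msuppX.
have mlcs : mlead (c * s) = mlead b.
  rewrite mleadM // /c mleadZ ?mulf_neq0 ?invr_neq0 ?mleadc_eq0 // mleadXm.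
  by rewrite submK.
have lt : (mlead b1 < mlead b)%O.
  rewrite lt_neqAle; apply/andP; split.
    apply: contraNneq b1n0 => E; rewrite -mleadc_eq0 E /b1 mcoeffB -{2}mlcs.
    rewrite mleadM // mleadcM {1 2}/c mleadcZE mleadXm mcoeffX eqxx mulr1 divfK // subrr //.
  apply: le_trans (mleadB_le _ _) _; rewrite mlcs joinxx //.
have [c' e'] : exists c', b1 = c' * s.
  apply: IH => // k; have [g [q [g0 gk e]]] := h k.
  by exists g, (q - g * c); split => //; rewrite /b1 mulrBr mulrBl e mulrA.
by exists (c' + c); rewrite mulrDl -e' /b1 subrK.
Qed.

(** * Polynomial solutions of the Herzog-Kuehl system *)

Section KernelMinors.
Variables (A : comNzRingType) (n : nat) (M : 'M[A]_(n, n.+1)).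

Let bordered (y : 'I_n.+1 -> A) : 'M[A]_n.+1 :=
  \matrix_(a, c) if unlift ord0 a is Some k then M k c else y c.

Let cofactor_bordered y i : cofactor (bordered y) ord0 i = (-1) ^+ i * \det (col' i M).
Proof.
rewrite /cofactor add0n; congr (_ * \det _); apply/matrixP => k c.
by rewrite !mxE liftK.
Qed.

Let det_bordered y : \det (bordered y) = \sum_i y i * ((-1) ^+ i * \det (col' i M)).
Proof.
rewrite (expand_det_row _ ord0); apply: eq_bigr => i _.
by rewrite cofactor_bordered mxE unlift_none.
Qed.

Lemma minors_in_kernel k : \sum_i M k i * ((-1) ^+ i * \det (col' i M)) = 0.
Proof.
rewrite -det_bordered; apply: (determinant_alternate (neq_lift ord0 k)) => c.
by rewrite !mxE liftK unlift_none.
Qed.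

(** Border the matrix by the [j]-th unit vector and multiply the column [b] by its
    adjugate: the only nonzero entry of the product of the bordered matrix and [b] is
    [b j]. *)
Lemma kernel_proportional (b : 'I_n.+1 -> A) : (forall k, \sum_i M k i * b i = 0) ->
  forall i j : 'I_n.+1, b i * ((-1) ^+ j * \det (col' j M)) = (-1) ^+ i * \det (col' i M) * b j.
Proof.
move=> hb i j; pose X := bordered (fun c => (c == j)%:R); pose v : 'cV[A]_n.+1 := \col_c b c.
have dX : \det X = (-1) ^+ j * \det (col' j M).
  rewrite det_bordered (bigD1 j) //= eqxx mul1r big1 ?addr0 // => c /negbTE->.
  by rewrite mul0r.
have Xv a : (X *m v) a 0 = if unlift ord0 a is Some k then 0 else b j.
  rewrite mxE; case: unliftP => [k|] ->.
    by rewrite -[RHS](hb k); apply: eq_bigr => c _; rewrite !mxE liftK.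
  rewrite (bigD1 j) //= !mxE unlift_none eqxx mul1r big1 ?addr0 // => c /negbTE ne.
  by rewrite !mxE unlift_none ne mul0r.
have e : \det X * b i = \sum_a \adj X i a * (X *m v) a 0.
  transitivity ((\det X *: v) i 0); first by rewrite !mxE.
  by rewrite -mul_scalar_mx -mul_adj_mx -mulmxA mxE.
rewrite dX in e.
rewrite mulrC e (bigD1 ord0) //= Xv unlift_none big1 ?addr0 => [|a ne].
  by rewrite mxE cofactor_bordered.
by rewrite Xv; case: unliftP ne => [k _|->]; rewrite ?mulr0 ?eqxx.
Qed.

End KernelMinors.

Lemma schur_eval_rmorph (A B : comNzRingType) (g : {rmorphism A -> B}) n (lam : 'I_n -> nat) x :
  g (schur_eval lam x) = schur_eval lam (fun k => g (x k)).
Proof.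
by rewrite /schur_eval rmorph_sum; apply: eq_bigr => T _; rewrite rmorph_prod.
Qed.

Section AlternantCoef.
Variables (n : nat) (l : 'I_n -> nat).
Hypothesis l_inj : injective l.
Let a : {mpoly rat[n]} := alternant l (fun k => 'X_k).
Let mon (s : {perm 'I_n}) : 'X_{1..n} := [multinom l (s k) | k < n].

Lemma mon_inj : injective mon.
Proof.
move=> s1 s2 e; apply/permP => k; apply: l_inj.
by have := congr1 (fun M : 'X_{1..n} => M k) e; rewrite !mnmE.
Qed.

Lemma alternant_coef M : a@_M = \sum_(s : {perm 'I_n}) (-1) ^+ s * (mon s == M)%:R.
Proof.
rewrite /a /alternant /determinant (raddf_sum (mcoeff _)) /=; apply: eq_bigr => s _.
have -> : \prod_i (\matrix_(k, p) ('X_k : {mpoly rat[n]}) ^+ l p) i (s i) = 'X_[mon s].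
  by rewrite mpolyXE_id; apply: eq_bigr => i _; rewrite mxE mnmE.
by case: (odd_perm s); rewrite ?expr0 ?expr1 ?mul1r ?mulN1r ?mcoeffN mcoeffX.
Qed.

Lemma alternant_coef_mon s : a@_(mon s) = (-1) ^+ s.
Proof.
rewrite alternant_coef (bigD1 s) //= eqxx mulr1 big1 ?addr0 // => s' ne.
by rewrite (inj_eq mon_inj) (negbTE ne) mulr0.
Qed.

Lemma alternant_neq0 : a != 0.
Proof.
apply/eqP => a0; have := alternant_coef_mon 1%g.
by rewrite a0 mcoeff0 odd_perm1 expr0 => /eqP; rewrite eq_sym oner_eq0.
Qed.

(** Distinct permutations contribute distinct monomials, so all nonzero coefficients
    are signs. *)
Lemma alternant_mleadc : exists b : bool, mleadc a = (-1) ^+ b.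
Proof.
have : mleadc a != 0 by rewrite mleadc_eq0 alternant_neq0.
have [/existsP[s /eqP <-] _|] := boolP [exists s, mon s == mlead a].
  by exists (odd_perm s); rewrite alternant_coef_mon.
rewrite negb_exists => /forallP h; rewrite alternant_coef big1 ?eqxx // => s _.
by rewrite (negbTE (h s)) mulr0.
Qed.

End AlternantCoef.

Definition int_mpoly (n : nat) (p : {mpoly rat[n]}) : Prop := forall mm, p@_mm \is a Num.int.

Section IntMpoly.
Variable n : nat.
Implicit Types p q : {mpoly rat[n]}.

Lemma int_mpoly0 : int_mpoly (0 : {mpoly rat[n]}).
Proof. by move=> mm; rewrite mcoeff0 rpred0. Qed.

Lemma int_mpolyD p q : int_mpoly p -> int_mpoly q -> int_mpoly (p + q).
Proof. by move=> hp hq mm; rewrite mcoeffD rpredD. Qed.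

Lemma int_mpolyN p : int_mpoly p -> int_mpoly (- p).
Proof. by move=> hp mm; rewrite mcoeffN rpredN. Qed.

Lemma int_mpolyM p q : int_mpoly p -> int_mpoly q -> int_mpoly (p * q).
Proof. by move=> hp hq mm; rewrite mcoeffM rpred_sum // => i _; rewrite rpredM. Qed.

Lemma int_mpolyZ c p : c \is a Num.int -> int_mpoly p -> int_mpoly (c *: p).
Proof. by move=> hc hp mm; rewrite mcoeffZ rpredM. Qed.

Lemma int_mpolyX mm : int_mpoly ('X_[mm] : {mpoly rat[n]}).
Proof. by move=> mm'; rewrite mcoeffX; case: (_ == _). Qed.

Lemma int_mpoly1 : int_mpoly (1 : {mpoly rat[n]}).
Proof. by rewrite -mpolyX0; apply: int_mpolyX. Qed.

Lemma int_mpolyXn p k : int_mpoly p -> int_mpoly (p ^+ k).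
Proof.
move=> hp; elim: k => [|k IH]; first by rewrite expr0; apply: int_mpoly1.
by rewrite exprS; apply: int_mpolyM.
Qed.

Lemma int_mpoly_sum (I : Type) (s : seq I) (P : pred I) (F : I -> {mpoly rat[n]}) :
  (forall i, int_mpoly (F i)) -> int_mpoly (\sum_(i <- s | P i) F i).
Proof. by move=> h; apply: big_ind => //; [exact: int_mpoly0 | exact: int_mpolyD]. Qed.

Lemma int_mpoly_prod (I : Type) (s : seq I) (P : pred I) (F : I -> {mpoly rat[n]}) :
  (forall i, int_mpoly (F i)) -> int_mpoly (\prod_(i <- s | P i) F i).
Proof. by move=> h; apply: big_ind => //; [exact: int_mpoly1 | exact: int_mpolyM]. Qed.

(** The leading coefficient of [c] is that of the product up to sign; subtract its
    leading term and repeat. *)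
Lemma int_mpoly_cofactor (c a : {mpoly rat[n]}) (b : bool) :
  mleadc a = (-1) ^+ b -> int_mpoly a -> int_mpoly (c * a) -> int_mpoly c.
Proof.
move=> la ia; elim/mleadrect: c => c IH ica.
have [->|c0] := eqVneq c 0; first exact: int_mpoly0.
have ilc : mleadc c \is a Num.int.
  have := ica (mlead c + mlead a)%MM; rewrite mleadcM la => h.
  by rewrite -[mleadc c](signrMK b) rpredM ?rpredX ?rpredN1 // mulrC.
pose q := c - mleadc c *: 'X_[mlead c].
have ilt : int_mpoly (mleadc c *: 'X_[mlead c]) by apply/int_mpolyZ/int_mpolyX.
rewrite -[c](subrK (mleadc c *: 'X_[mlead c])) -/q; apply: int_mpolyD => //.
have [->|q0] := eqVneq q 0; first exact: int_mpoly0.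
apply: IH; first exact: ltm_mleadD.
by rewrite mulrBl; apply/int_mpolyD/int_mpolyN/int_mpolyM.
Qed.

End IntMpoly.

Section Solutions.
Variables (m : nat) (e e' : 'I_m.+1 -> nat) (r : nat).
Hypothesis e_gt0 : forall k, (0 < e k)%N.
Hypothesis r_gcd : r = \big[gcdn/0%N]_(k < m.+1) e k.
Hypothesis e_re' : forall k, e k = (r * e' k)%N.

Definition betti_poly (i : 'I_m.+2) : {mpoly rat[m.+1]} :=
  schur_eval (alpha e' i) (fun k => 'X_k ^+ r).

Let Delta : {mpoly rat[m.+1]} := diff_product (fun k => 'X_k ^+ r).
Let M : 'M[{mpoly rat[m.+1]}]_(m.+1, m.+2) := \matrix_(k, i) 'X_k ^+ tail_sum e i.

Lemma betti_poly_minor i : betti_poly i * Delta = \det (col' i M).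
Proof.
rewrite /betti_poly /Delta (schur_minor e_gt0 e_re').
by congr (\det _); apply/matrixP => k p; rewrite !mxE.
Qed.

Lemma minor_alternant i :
  \det (col' i M) = alternant (fun p => tail_sum e (fintype.lift i p)) (fun k => 'X_k).
Proof. by congr (\det _); apply/matrixP => k p; rewrite !mxE. Qed.

Lemma lift_tail_inj (i : 'I_m.+2) : injective (fun p => tail_sum e (fintype.lift i p)).
Proof. by move=> p q /(tail_sum_inj e_gt0)/lift_inj. Qed.

Lemma minor_neq0 i : \det (col' i M) != 0.
Proof. by rewrite minor_alternant; apply/alternant_neq0/lift_tail_inj. Qed.

Lemma betti_poly_neq0 i : betti_poly i != 0.
Proof. by have := minor_neq0 i; rewrite -betti_poly_minor mulf_eq0 negb_or => /andP[]. Qed.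

Lemma Delta_neq0 : Delta != 0.
Proof. by have := minor_neq0 ord0; rewrite -betti_poly_minor mulf_eq0 negb_or => /andP[]. Qed.

Lemma betti_poly_relation k : \sum_(i < m.+2) (-1) ^+ i * 'X_k ^+ tail_sum e i * betti_poly i = 0.
Proof.
apply: (mulIf Delta_neq0); rewrite mul0r -[RHS](minors_in_kernel M k) mulr_suml.
by apply: eq_bigr => i _; rewrite -betti_poly_minor mxE; ring.
Qed.

Lemma betti_poly_int i : int_mpoly (betti_poly i).
Proof.
by apply: int_mpoly_sum => T; apply: int_mpoly_prod => c; apply/int_mpolyXn/int_mpolyX.
Qed.

Lemma betti_poly_int_cofactor i (c : {mpoly rat[m.+1]}) :
  int_mpoly (c * betti_poly i) -> int_mpoly c.
Proof.
move=> h; have [b mb] := alternant_mleadc (@lift_tail_inj i).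
rewrite -minor_alternant -betti_poly_minor in mb.
have iD : int_mpoly Delta.
  apply: int_mpoly_prod => a; apply: int_mpoly_prod => a'.
  by apply/int_mpolyD/int_mpolyN/int_mpolyXn/int_mpolyX/int_mpolyXn/int_mpolyX.
apply: (int_mpoly_cofactor mb); first by apply: int_mpolyM => //; apply: betti_poly_int.
by rewrite mulrA; apply: int_mpolyM.
Qed.

Lemma isolate_var_betti_poly k0 i : isolate_var k0 (betti_poly i) =
  schur_eval (alpha e' i) (fun k => node_var k0 (fun j => 'X_j : {mpoly rat[m]}) k ^+ r).
Proof.
rewrite /isolate_var /betti_poly schur_eval_rmorph; apply: eq_bigr => T _; apply: eq_bigr => c _.
by rewrite rmorphXn /= mmapX mmap1U.
Qed.

Lemma isolate_varM k0 (p q : {mpoly rat[m.+1]}) :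
  isolate_var k0 (p * q) = isolate_var k0 p * isolate_var k0 q.
Proof. exact: rmorphM. Qed.

(** Both [B] and the Betti polynomials lie in the kernel of a matrix of corank one, so
    [B_i S_j = S_i B_j].  As the [S_i] have no common factor in any one of the
    variables, [S_0] divides [B_0] up to factors free of that variable. *)
Theorem solution_multiple_betti (B : 'I_m.+2 -> {mpoly rat[m.+1]}) :
  (forall k, \sum_(i < m.+2) (-1) ^+ i * 'X_k ^+ tail_sum e i * B i = 0) ->
  exists c, forall i, B i = c * betti_poly i.
Proof.
move=> rel.
have cross i j : B i * betti_poly j = betti_poly i * B j.
  have hb k : \sum_i M k i * ((-1) ^+ i * B i) = 0.
    by rewrite -[RHS](rel k); apply: eq_bigr => l _; rewrite mxE; ring.
  have := kernel_proportional hb i j; rewrite -!betti_poly_minor => E.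
  have s0 : (-1) ^+ (i + j) * Delta != 0 by rewrite mulf_neq0 ?signr_eq0 // Delta_neq0.
  apply: (mulfI s0); rewrite exprD.
  transitivity ((-1) ^+ i * B i * ((-1) ^+ j * (betti_poly j * Delta))); first by ring.
  by rewrite E; ring.
have [c Bc] : exists c, B ord0 = c * betti_poly ord0.
  apply: mpoly_dvd_of_free (betti_poly_neq0 ord0) _ => k0.
  apply: dvd_isolate_var.
  apply: (@coprime_cancel _ _ (fun i => isolate_var k0 (betti_poly i)) ord0).
  - apply: contra_neq (betti_poly_neq0 ord0) => h; apply: (@isolate_var_inj _ _ k0).
    rewrite h; exact/esym/rmorph0.
  - move=> p irr h; apply: (schur_no_common_factor e_gt0 r_gcd e_re' irr) => i.
    have := h i; rewrite isolate_var_betti_poly; exact.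
  - move=> i; rewrite -isolate_varM cross isolate_varM; exact: dvdp_mulr.
exists c => i; apply: (mulIf (betti_poly_neq0 ord0)).
by rewrite cross Bc; ring.
Qed.
End Solutions.

(** * Laurent polynomials and diagrams *)

Section IntegerCoef.
Variable n : nat.
Implicit Types (P Q : {mpoly rat[n]}) (a b N : 'rV[int]_n) (mm : 'X_{1..n}).

Definition nonneg a : bool := [forall k, 0 <= a 0 k].
Definition exponent a : 'X_{1..n} := [multinom absz (a 0%R k) | k < n].
Definition mnm_row mm : 'rV[int]_n := \row_k (mm k)%:Z.
(** The coefficient at an integer vector.  Extending coefficients by zero to negative
    exponents turns multiplication by a monomial into a translation without side
    conditions, see [coefZXM]. *)
Definition coefZ P a : rat := if nonneg a then P@_(exponent a) else 0.

Lemma nonneg_mnm_row mm : nonneg (mnm_row mm).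
Proof. by apply/forallP => k; rewrite mxE. Qed.

Lemma mnm_rowK mm : exponent (mnm_row mm) = mm.
Proof. by apply/mnmP => k; rewrite mnmE mxE. Qed.

Lemma exponentK a : nonneg a -> mnm_row (exponent a) = a.
Proof. by move=> /forallP h; apply/rowP => k; rewrite mxE mnmE gez0_abs. Qed.

Lemma coefZ_mnm_row P mm : coefZ P (mnm_row mm) = P@_mm.
Proof. by rewrite /coefZ nonneg_mnm_row mnm_rowK. Qed.

Lemma coefZ0 a : coefZ 0 a = 0.
Proof. by rewrite /coefZ mcoeff0 if_same. Qed.

Lemma coefZ_sum a (I : Type) (s : seq I) (F : I -> {mpoly rat[n]}) :
  coefZ (\sum_(i <- s) F i) a = \sum_(i <- s) coefZ (F i) a.
Proof.
rewrite /coefZ; case: ifP => _; last by rewrite big1.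
by rewrite (raddf_sum (mcoeff _)).
Qed.

Lemma coefZZ c P a : coefZ (c *: P) a = c * coefZ P a.
Proof. by rewrite /coefZ mcoeffZ; case: ifP => // _; rewrite mulr0. Qed.

Lemma coefZXM mm P a : coefZ ('X_[mm] * P) a = coefZ P (a - mnm_row mm).
Proof.
rewrite /coefZ; case: (boolP (nonneg (a - mnm_row mm))) => [h|h].
  have ha : nonneg a.
    apply/forallP => k; have /forallP/(_ k) := h; rewrite !mxE subr_ge0.
    by apply: le_trans.
  rewrite ha mulrC -[exponent a](_ : (mm + exponent (a - mnm_row mm))%MM = _) ?mcoeffMX //.
  apply/mnmP => k; rewrite mnmDE !mnmE !mxE.
  have /forallP/(_ k) := h; rewrite !mxE => h1.
  by move: (a 0 k) (mm k) h1 => x y h1; lia.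
case: ifP => // ha; rewrite mcoeffM big1 // => k /eqP e.
case: (eqVneq (mm : 'X_{1..n}) k.1) => [e1|ne]; last by rewrite mcoeffX (negbTE ne) mul0r.
case/negP: h; apply/forallP => i; rewrite !mxE subr_ge0.
have := congr1 (fun x : 'X_{1..n} => x i) e; rewrite mnmDE -e1 mnmE.
have /forallP/(_ i) := ha; rewrite /= => h1 h2.
by move: (mm i) (a _ i) h1 h2 => y z h1 h2; lia.
Qed.

Lemma coefZ_inj P Q : (forall a, coefZ P a = coefZ Q a) -> P = Q.
Proof. by move=> h; apply/mpolyP => mm; rewrite -!coefZ_mnm_row. Qed.

Lemma coefZM P Q a : coefZ (P * Q) a = \sum_(mm <- msupp P) P@_mm * coefZ Q (a - mnm_row mm).
Proof.
rewrite {1}[P]mpolyE mulr_suml coefZ_sum; apply: eq_bigr => mm _.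
by rewrite -scalerAl coefZZ coefZXM.
Qed.

Lemma nonneg_translate (s : seq 'rV[int]_n) : exists N, nonneg N /\ {in s, forall t, nonneg (N - t)}.
Proof.
exists (\row_k \sum_(t <- s) `|t 0 k|); split.
  by apply/forallP => k; rewrite mxE sumr_ge0.
move=> t ts; apply/forallP => k; rewrite !mxE subr_ge0 (big_rem t) //=.
rewrite (le_trans (ler_norm _)) // lerDl; exact: sumr_ge0.
Qed.

(** The Laurent polynomial [sum_t C_t X^(-t)] multiplied by [X^N].  The sign is that of
    twists: [twist beta t] has Betti polynomials [X^(-t) B_i]. *)
Definition laurent_poly (C : {freeg 'rV[int]_n / rat}) N : {mpoly rat[n]} :=
  \sum_(t <- dom C) coeff t C *: 'X_[exponent (N - t)].

Lemma coef_laurent_poly C N mm : {in dom C, forall t, nonneg (N - t)} ->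
  (laurent_poly C N)@_mm = coeff (N - mnm_row mm) C.
Proof.
move=> good; rewrite -{2}[C]freeg_sumE /laurent_poly (raddf_sum (mcoeff _)) (raddf_sum (coeff _)) /=.
rewrite !big_seq; apply: eq_bigr => t tC; rewrite mcoeffZ mcoeffX coeffU; congr (_ * _%:R).
congr nat_of_bool; apply/eqP/eqP => [<-|->]; last by rewrite subKr mnm_rowK.
by rewrite exponentK ?good // subKr.
Qed.

(** The right-hand side is the coefficient of a combination of twists. *)
Lemma coefZ_laurent_polyM C N Q a : {in dom C, forall t, nonneg (N - t)} ->
  coefZ (laurent_poly C N * Q) (a + N) = \sum_(t <- dom C) coeff t C * coefZ Q (a + t).
Proof.
move=> good; rewrite /laurent_poly mulr_suml coefZ_sum !big_seq; apply: eq_bigr => t tC.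
by rewrite -scalerAl coefZZ coefZXM exponentK ?good // opprB [X in coefZ Q X]addrC
  [a + N]addrC addrA subrK addrC.
Qed.

End IntegerCoef.

Section Diagrams.
Variable n : nat.
Implicit Types (beta : diagram n) (a t : 'rV[int]_n).

Lemma coeff_twist beta t x : coeff x (twist beta t) = coeff (x.1, x.2 + t) beta.
Proof.
rewrite /twist -[in RHS](freeg_sumE beta) !(raddf_sum (coeff _)) /=; apply: eq_bigr => y _.
rewrite !coeffU; congr (_ * _%:R); congr nat_of_bool.
by case: x y => [i a] [j b]; rewrite /= !xpair_eqE subr_eq.
Qed.

Lemma coeff_diagram_of (B : 'I_n.+1 -> {mpoly rat[n]}) i a :
  coeff (i, a) (diagram_of B) = coefZ (B i) a.
Proof.
rewrite /diagram_of (raddf_sum (coeff _)) /= (bigD1 i) //= [X in _ + X]big1 ?addr0 => [|j ne].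
  rewrite (raddf_sum (coeff _)) /= /coefZ; case: ifP => ha.
    rewrite {3}[B i]mpolyE (raddf_sum (mcoeff _)) /=; apply: eq_bigr => mm _.
    rewrite coeffU mcoeffZ mcoeffX xpair_eqE eqxx -/(mnm_row mm); congr (_ * _%:R); congr nat_of_bool.
    by apply/eqP/eqP => [<-|->]; rewrite ?mnm_rowK ?exponentK.
  rewrite big1 // => mm _; rewrite coeffU xpair_eqE eqxx -/(mnm_row mm).
  by case: eqP => [e|]; rewrite ?mulr0 //; move: ha; rewrite -e nonneg_mnm_row.
rewrite (raddf_sum (coeff _)) big1 // => mm _ /=.
by rewrite coeffU xpair_eqE (negbTE ne) mulr0.
Qed.

End Diagrams.

(** * Pure diagrams and the span L'(e) *)

Lemma schur_eval_homogeneous (n : nat) (lam : 'I_n -> nat) (r : nat) (mm : 'X_{1..n}) :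
  mdeg mm != (r * \sum_k lam k)%N ->
  (schur_eval lam (fun k => 'X_k ^+ r) : {mpoly rat[n]})@_mm = 0.
Proof.
move=> ne; rewrite /schur_eval (raddf_sum (mcoeff _)) big1 // => T _ /=.
rewrite mprodXnE mcoeffX; case: eqP => // e; case/eqP: ne; rewrite -e mdeg_sum.
rewrite (eq_bigr (fun=> r)) => [|c _]; last by rewrite mdegMn mdeg1 mul1n.
rewrite big_distrr /= -(@sig_big_dep _ _ _ _ _ xpredT (fun _ => xpredT) (fun k (j : 'I_(lam k)) => r)) /=.
by apply: eq_bigr => k _; rewrite sum_nat_const card_ord mulnC.
Qed.

Lemma schur_compE (n : nat) (lam : 'I_n -> nat) (r : nat) :
  schur lam \mPo [tuple 'X_j ^+ r | j < n] = schur_eval lam (fun k => 'X_k ^+ r).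
Proof.
rewrite /schur rmorph_sum; apply: eq_bigr => T _.
rewrite rmorph_prod; apply: eq_bigr => c _ /=.
by rewrite comp_mpolyXU -tnth_nth tnth_mktuple.
Qed.

Section TotalDegree.
Variable n : nat.
Implicit Types a b : 'rV[int]_n.

Definition slide (k : 'I_n) (c : nat) a : 'rV[int]_n := a - c%:Z *: delta_mx 0 k.

Lemma total_degreeD a b : total_degree (a + b) = total_degree a + total_degree b.
Proof. by rewrite /total_degree -big_split; apply: eq_bigr => k _; rewrite mxE. Qed.

Lemma total_degreeN a : total_degree (- a) = - total_degree a.
Proof. by rewrite /total_degree -sumrN; apply: eq_bigr => k _; rewrite mxE. Qed.

Lemma total_degree_slide k c a : total_degree (slide k c a) = total_degree a - c%:Z.
Proof.
rewrite total_degreeD total_degreeN; congr (_ - _).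
rewrite /total_degree (bigD1 k) //= big1 => [|j ne]; first by rewrite !mxE !eqxx mulr1 addr0.
by rewrite !mxE (negbTE ne) andbF mulr0.
Qed.

Lemma total_degree_col' k a : total_degree a = a 0 k + \sum_j (col' k a) 0 j.
Proof.
by rewrite /total_degree (bigD1_ord k) //=; congr (_ + _); apply: eq_bigr => j _; rewrite mxE.
Qed.

Lemma col'_slide k c a : col' k (slide k c a) = col' k a.
Proof.
by apply/rowP => j; rewrite !mxE eq_sym (negbTE (neq_lift _ _)) andbF mulr0 subr0.
Qed.

Lemma eq_col'_degree k a b : col' k a = col' k b -> total_degree a = total_degree b -> a = b.
Proof.
move=> e; rewrite !(total_degree_col' k) e => /addIr ek.
apply/rowP => j; case: (unliftP k j) => [j'|] -> //.
by have := congr1 (fun N : 'rV_n.-1 => N 0 j') e; rewrite !mxE.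
Qed.

(** The removed coordinate is free to adjust the total degree. *)
Lemma exists_col'_degree (k : 'I_n) (ahat : 'rV[int]_n.-1) (D : int) :
  exists a, col' k a = ahat /\ total_degree a = D.
Proof.
pose a : 'rV[int]_n := \row_j if unlift k j is Some j' then ahat 0 j' else D - \sum_j' ahat 0 j'.
have ea : col' k a = ahat by apply/rowP => j; rewrite !mxE liftK.
by exists a; split => //; rewrite (total_degree_col' k) ea mxE unlift_none subrK.
Qed.

Lemma total_degree_exponent a : nonneg a -> total_degree a = (mdeg (exponent a))%:Z.
Proof.
move=> /forallP h; rewrite mdegE (big_morph Posz PoszD (erefl _)).
by apply: eq_bigr => k _; rewrite mnmE gez0_abs.
Qed.

End TotalDegree.

Section Degrees.
Variables (n : nat) (e : 'I_n -> nat).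
Hypothesis e_gt0 : forall k, (0 < e k)%N.
Implicit Types beta : diagram n.

Lemma constant_ord (T : Type) (f : 'I_n.+1 -> T) :
  (forall k : 'I_n, f (widen_ord (leqnSn n) k) = f (fintype.lift ord0 k)) ->
  forall i, f i = f ord_max.
Proof.
move=> h i; have [j] := ubnP (n - i)%N; elim: j i => // j IH i; rewrite ltnS => le.
case: (ltnP i n) => lt; last first.
  by congr f; apply: val_inj; apply/eqP; rewrite eqn_leq leq_ord.
have -> : i = widen_ord (leqnSn n) (Ordinal lt) by apply: val_inj.
rewrite h IH // lift0 /=; lia.
Qed.

(** The degrees [d_i] are determined by the last one; the differences [e_k] being positive, they
    increase automatically. *)
Lemma pureP beta : pure e beta <-> exists D : int, forall i a,
  total_degree a != D - (tail_sum e i)%:Z -> coeff (i, a) beta = 0.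
Proof.
split=> [[d [_ hd hb]]|[D hD]].
  exists (d ord_max) => i a; rewrite (_ : _ - _ = d i); first exact: hb.
  have c : forall i, d i + (tail_sum e i)%:Z = d ord_max + (tail_sum e ord_max)%:Z.
    apply: constant_ord => k; rewrite tail_sum_step PoszD -(hd k); ring.
  by rewrite -[d ord_max]addr0 -[0]/(0%:Z) -(tail_sum_max e) -(c i) addrK.
exists (fun i => D - (tail_sum e i)%:Z); split => // [i j lt|k].
  by rewrite ltrD2l ltrN2 ltz_nat; apply: tail_sum_anti.
by rewrite tail_sum_step PoszD; ring.
Qed.

(** The coefficients of the equations [sum_i (-1)^i t_k^(mu_i) B_i = 0]. *)
Definition slide_relation beta : Prop := forall k (M : 'rV[int]_n),
  \sum_(i < n.+1) (-1) ^+ i * coeff (i, slide k (tail_sum e i) M) beta = 0.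

Lemma sum_dom_pred1 (K : choiceType) (beta : {freeg K / rat}) (P : pred K) (F : K -> rat) (y : K) :
  {in dom beta, forall x, P x = (x == y)} -> (y \notin dom beta -> F y = 0) ->
  \sum_(x <- dom beta | P x) F x = F y.
Proof.
move=> hP hF; rewrite big_seq_cond (eq_bigl (fun x => (x \in dom beta) && (x == y))); last first.
  by move=> x; case: (boolP (x \in dom beta)) => // /hP.
rewrite -big_seq_cond; case: (boolP (y \in dom beta)) => yd.
  by rewrite -big_filter filter_pred1_uniq ?uniq_dom // big_seq1.
rewrite hF // big_seq_cond big_pred0 // => x; apply/negP => /andP[xd /eqP xy].
by move: yd; rewrite -xy xd.
Qed.

(** In a line parallel to the [k]-th axis each total degree occurs exactly once, so for
    each [i] a single point of the line can carry an entry of a pure diagram. *)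
Lemma herzog_kuhl_slide beta : pure e beta -> (herzog_kuhl beta <-> slide_relation beta).
Proof.
move=> /pureP[D hD].
have main k M : total_degree M = D ->
    \sum_(x <- dom beta | col' k x.2 == col' k M) (-1) ^+ x.1 * coeff x beta =
    \sum_(i < n.+1) (-1) ^+ i * coeff (i, slide k (tail_sum e i) M) beta.
  move=> dM; rewrite (partition_big (fun x : 'I_n.+1 * 'rV[int]_n => x.1) xpredT) //=.
  apply: eq_bigr => i _; apply: (@sum_dom_pred1 _ beta) => [[j a] xd|/coeff_outdom->]; last first.
    by rewrite mulr0.
  rewrite /= xpair_eqE andbC; case: eqP => //= ej; subst j.
  apply/eqP/eqP => [ec|->]; last by rewrite col'_slide.
  apply: (@eq_col'_degree _ k); first by rewrite col'_slide.
  rewrite total_degree_slide dM; apply/eqP.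
  by apply: contraTT xd => /hD c0; rewrite mem_dom c0 eqxx.
split=> [hk k M|hs k ahat]; last first.
  have [M [<- dM]] := exists_col'_degree k ahat D.
  by rewrite main.
have [dM|dM] := eqVneq (total_degree M) D; first by rewrite -main.
rewrite big1 // => i _; rewrite hD ?mulr0 // total_degree_slide.
by rewrite (inj_eq (addIr _)).
Qed.

(** The relation is linear in the diagram and does not mention the degrees, so it passes
    to combinations of generators with different degrees. *)
Lemma Lprime_slide beta : Lprime e beta -> slide_relation beta.
Proof.
case=> s [hs ->] k M.
have : forall p, p \in s -> slide_relation p.2.
  by move=> p /hs[hp hh]; apply/(herzog_kuhl_slide hp).
elim: s {hs} => [|p s IH] h.
  by rewrite big_nil big1 // => i _; rewrite coeff0 mulr0.
rewrite big_cons (eq_bigr (fun i : 'I_n.+1 =>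
   p.1 * ((-1) ^+ i * coeff (i, slide k (tail_sum e i) M) p.2) +
   (-1) ^+ i * coeff (i, slide k (tail_sum e i) M) (\sum_(p <- s) p.1 *: p.2))) => [|i _].
  rewrite big_split -mulr_sumr /= h ?mem_head // mulr0 add0r IH // => q qs.
  by apply: h; rewrite inE qs orbT.
by rewrite coeffD coeffZ; ring.
Qed.

Lemma Lprime_of_slide beta : pure e beta -> slide_relation beta -> Lprime e beta.
Proof.
move=> hp hs; exists [:: (1, beta)]; split; last by rewrite big_seq1 scale1r.
by move=> p; rewrite inE => /eqP->; split => //; apply/(herzog_kuhl_slide hp).
Qed.

End Degrees.

(** * The twists of the equivariant diagram form bases *)

Lemma slide_relation_poly (n : nat) (e : 'I_n -> nat) (beta : diagram n)
    (B : 'I_n.+1 -> {mpoly rat[n]}) (N : 'rV[int]_n) :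
  (forall i a, coeff (i, a) beta = coefZ (B i) (a + N)) ->
  slide_relation e beta <-> forall k, \sum_(i < n.+1) (-1) ^+ i * 'X_k ^+ tail_sum e i * B i = 0.
Proof.
move=> hB.
have main k M : coefZ (\sum_(i < n.+1) (-1) ^+ i * 'X_k ^+ tail_sum e i * B i) (M + N) =
    \sum_(i < n.+1) (-1) ^+ i * coeff (i, slide k (tail_sum e i) M) beta.
  rewrite coefZ_sum; apply: eq_bigr => i _.
  have -> : (-1) ^+ i * 'X_k ^+ tail_sum e i * B i =
      (-1) ^+ i *: ('X_[U_(k) *+ tail_sum e i] * B i).
    by rewrite mpolyXn -[in RHS]mul_mpolyC rmorphXn rmorphN1 mulrA.
  rewrite coefZZ coefZXM hB; congr (_ * coefZ _ _).
  rewrite /slide addrAC; congr (_ - _ + _); apply/rowP => j.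
  by rewrite !mxE mulmnE mnm1E eq_sym; case: (j == k); rewrite ?mul1n ?mul0n ?mulr1 ?mulr0.
split=> [h k|h k M]; last by rewrite -main h coefZ0.
apply: coefZ_inj => a; by rewrite -[a](subrK N) main h coefZ0.
Qed.

(** A translation [N] moves the finite support into the nonnegative orthant. *)
Lemma diagram_poly (n : nat) (beta : diagram n) : exists N (B : 'I_n.+1 -> {mpoly rat[n]}),
  nonneg N /\ forall i a, coeff (i, a) beta = coefZ (B i) (a + N).
Proof.
have [N [N0 hN]] := nonneg_translate [seq - x.2 | x <- dom beta].
pose C i : {freeg 'rV[int]_n / rat} := \sum_(x <- dom beta | x.1 == i) << coeff x beta *g - x.2 >>.
have coefC i a : coeff (- a) (C i) = coeff (i, a) beta.
  rewrite /C (raddf_sum (coeff _)) /= -[in RHS](freeg_sumE beta) (raddf_sum (coeff _)) /=.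
  rewrite big_mkcond; apply: eq_bigr => -[j b] _; rewrite !coeffU xpair_eqE /= eqr_opp.
  by case: (j == i); rewrite ?mulr0.
have good i : {in dom (C i), forall t, nonneg (N - t)}.
  move=> t; rewrite mem_dom -[t]opprK coefC => h; apply: hN; apply/mapP.
  by exists (i, - t); rewrite ?mem_dom ?opprK.
exists N, (fun i => laurent_poly (C i) N); split=> // i a; rewrite -coefC -[LHS]mulr1.
rewrite /coefZ; case: ifP => ha.
  by rewrite mulr1 coef_laurent_poly // exponentK // opprD [- a - N]addrC addrA subrr add0r.
rewrite mulr1; apply/eqP; rewrite -[_ == 0]negbK -mem_dom; apply/negP => /good.
by rewrite opprK addrC ha.
Qed.

Lemma fglift_sum (R : nzRingType) (V : lmodType R) (I : choiceType) (b : I -> V) (J : Type)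
    (l : seq J) (F : J -> {freeg I / R}) :
  fglift b (\sum_(j <- l) F j) = \sum_(j <- l) fglift b (F j).
Proof.
have sub := lift_is_additive b.
have lift0 : fglift b 0 = 0 by rewrite -[X in fglift b X](subrr 0) sub subrr.
apply: (big_morph _ _ lift0) => x y.
by rewrite -[y in LHS]opprK -[- y]sub0r !sub lift0 sub0r opprK.
Qed.

Lemma fgliftE (R : nzRingType) (V : lmodType R) (I : choiceType) (b : I -> V)
    (C : {freeg I / R}) : fglift b C = \sum_(t <- dom C) coeff t C *: b t.
Proof.
by rewrite -[in LHS](freeg_sumE C) fglift_sum; apply: eq_bigr => t _; rewrite liftU.
Qed.

Section Basis.
Variables (m : nat) (e e' : 'I_m.+1 -> nat) (r : nat).
Hypothesis e_gt0 : forall k, (0 < e k)%N.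
Hypothesis r_gcd : r = \big[gcdn/0%N]_(k < m.+1) e k.
Hypothesis e_re' : forall k, e k = (r * e' k)%N.

Let n := m.+1.
Let S : diagram n := betti_equivariant e' r.
Let s i : {mpoly rat[n]} := betti_poly e' r i.

Lemma coeff_betti i a : coeff (i, a) S = coefZ (s i) a.
Proof. by rewrite coeff_diagram_of schur_compE. Qed.

Lemma coeff_twist_betti t i a : coeff (i, a) (twist S t) = coefZ (s i) (a + t).
Proof. by rewrite coeff_twist coeff_betti. Qed.

Lemma Lprime_twist_betti t : Lprime e (twist S t).
Proof.
apply: (Lprime_of_slide e_gt0).
  apply/(pureP e_gt0); exists ((r * \sum_k (lambda e' k + e' k))%N%:Z - total_degree t) => i a.
  move=> ne; rewrite coeff_twist_betti /coefZ; case: ifP => // ha.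
  apply: schur_eval_homogeneous; apply: contra_neq ne => dg.
  apply: (addIr (total_degree t)); rewrite -total_degreeD total_degree_exponent // dg.
  have -> : (\sum_k (lambda e' k + e' k) = \sum_k alpha e' i k + tail_sum e' i)%N.
    rewrite /tail_sum [X in (_ + X)%N]big_mkcond -big_split /=; apply: eq_bigr => k _.
    by rewrite /alpha -addnA; congr (_ + _)%N; case: ltnP; rewrite ?addn0.
  rewrite (tail_sum_scaled e_re') mulnDr PoszD; ring.
apply/(@slide_relation_poly _ _ _ s t (coeff_twist_betti t)).
exact: (betti_poly_relation e_gt0 e_re').
Qed.

(** Every element of the span is a Laurent multiple of the equivariant diagram; [c] is
    this multiple times [X^N]. *)
Lemma Lprime_poly beta : Lprime e beta -> exists N c, nonneg N /\
  forall i a, coeff (i, a) beta = coefZ (c * s i) (a + N).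
Proof.
move=> /(Lprime_slide e_gt0) hs; have [N [B [N0 hB]]] := diagram_poly beta.
have /(solution_multiple_betti e_gt0 r_gcd e_re')[c hc] := (@slide_relation_poly _ _ _ _ _ hB).1 hs.
by exists N, c; split => // i a; rewrite hB hc.
Qed.

Lemma coeff_fglift (beta : diagram n) (Q : 'I_n.+1 -> {mpoly rat[n]}) N C K i a :
  (forall i a, coeff (i, a) beta = coefZ (Q i) (a + N)) ->
  {in dom C, forall t, nonneg (K - t)} ->
  coeff (i, a) (fglift (twist beta) C) = coefZ (laurent_poly C K * Q i) (a + N + K).
Proof.
move=> hQ good; rewrite coefZ_laurent_polyM // fgliftE (raddf_sum (coeff _)) /=.
by apply: eq_bigr => t _; rewrite coeffZ coeff_twist hQ addrAC.
Qed.

Lemma fglift_poly beta N c : (forall i a, coeff (i, a) beta = coefZ (c * s i) (a + N)) ->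
  beta = fglift (twist S) (\sum_(mm <- msupp c) << c@_mm *g N - mnm_row mm >>).
Proof.
move=> h; apply/eqP/freeg_eqP => -[i a]; rewrite h coefZM fglift_sum (raddf_sum (coeff _)) /=.
by apply: eq_bigr => mm _; rewrite liftU coeffZ coeff_twist_betti addrA.
Qed.

(** A combination of twists is the diagram multiplied by a Laurent polynomial, and
    polynomials over a field form a domain. *)
Lemma fglift_inj C : fglift (twist S) C = 0 -> C = 0.
Proof.
move=> h; have [K [_ good]] := nonneg_translate (dom C).
have p0 : laurent_poly C K = 0.
  apply: (mulIf (betti_poly_neq0 e_gt0 e_re' ord0)); rewrite mul0r.
  apply: coefZ_inj => a; rewrite -[a](subrK K) -[a - K]addr0.
  rewrite -(coeff_fglift ord0 (a - K) (N := 0) (beta := S) (Q := s)) //; last first.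
    by move=> i b; rewrite addr0 coeff_betti.
  by rewrite h coeff0 coefZ0.
apply/eqP/freeg_eqP => t; rewrite coeff0; case: (boolP (t \in dom C)) => [td|/coeff_outdom//].
have := coef_laurent_poly (exponent (K - t)) good; rewrite p0 mcoeff0 exponentK ?good //.
by rewrite subKr.
Qed.

Lemma rational_twist_basis : is_basis (Lprime e) (twist S).
Proof.
split; [exact: Lprime_twist_betti | | exact: fglift_inj].
by move=> v /Lprime_poly[N [c [_ h]]]; eexists; exact: fglift_poly h.
Qed.

(** Extension of scalars from integers to rationals; it reduces the statements about
    lattices to those about vector spaces. *)
Definition rat_freeg (I : choiceType) (c : {freeg I / int}) : {freeg I / rat} :=
  \sum_(x <- dom c) << (coeff x c)%:~R *g x >>.

Lemma coeff_rat_freeg (I : choiceType) (c : {freeg I / int}) x : coeff x (rat_freeg c) = (coeff x c)%:~R.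
Proof.
rewrite /rat_freeg (raddf_sum (coeff _)) /= -[in RHS](freeg_sumE c) (raddf_sum (coeff _)) rmorph_sum /=.
by apply: eq_bigr => y _; rewrite !coeffU rmorphM /=; case: (_ == _).
Qed.

Lemma lattice_lift (V : lmodType rat) (I : choiceType) (b : I -> V) (c : {freeg I / int}) :
  (fglift (b : I -> zmodule V) c : V) = fglift b (rat_freeg c).
Proof.
rewrite fgliftE /rat_freeg fglift_sum; apply: eq_bigr => x _.
by rewrite liftU scalezrE scaler_int.
Qed.

Lemma Lprime_int_coef beta N c : Lprime_int e beta ->
  (forall i a, coeff (i, a) beta = coefZ (c * s i) (a + N)) -> int_mpoly c.
Proof.
move=> [_ hi] h; apply: (@betti_poly_int_cofactor _ e e' r e_gt0 e_re' ord0) => mm.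
by rewrite -coefZ_mnm_row -[mnm_row mm](subrK N) -h.
Qed.

Lemma Lprime_int_twist_betti t : Lprime_int e (twist S t).
Proof.
split; first exact: Lprime_twist_betti.
move=> [i a]; rewrite coeff_twist_betti /coefZ; case: ifP => // _.
exact: betti_poly_int.
Qed.

Lemma lattice_twist_basis : is_lattice_basis (Lprime_int e) (twist S).
Proof.
split; first exact: Lprime_int_twist_betti.
- move=> v hv; have [N [c [_ h]]] := Lprime_poly hv.1.
  have ic := Lprime_int_coef hv h.
  pose C : {freeg 'rV[int]_n / int} := \sum_(mm <- msupp c) << numq c@_mm *g N - mnm_row mm >>.
  have CE : rat_freeg C = \sum_(mm <- msupp c) << c@_mm *g N - mnm_row mm >>.
    apply/eqP/freeg_eqP => t; rewrite coeff_rat_freeg !(raddf_sum (coeff _)) rmorph_sum /=.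
    apply: eq_bigr => mm _; rewrite !coeffU rmorphM rmorph_nat /=; congr (_ * _).
    by have /intrP[z ->] := ic mm; rewrite numq_int.
  exists C; rewrite (lattice_lift (V := diagram n)) CE; exact: fglift_poly h.
- move=> c; rewrite (lattice_lift (V := diagram n)) => /fglift_inj h.
  apply/eqP/freeg_eqP => t; rewrite coeff0; apply/eqP.
  by rewrite -(intr_eq0 rat) -coeff_rat_freeg h coeff0.
Qed.

End Basis.

(** * Uniqueness of the generator *)

(** The smallest monomials of the factors multiply without cancellation, as the largest
    ones do. *)
Lemma mcoeffM_mlast (n : nat) (R : idomainType) (p q : {mpoly R[n]}) : p != 0 -> q != 0 ->
  (p * q)@_(mlast p + mlast q) = p@_(mlast p) * q@_(mlast q).
Proof.
move=> p0 q0; rewrite mpolyME big_allpairs (raddf_sum (mcoeff _)).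
rewrite (bigD1_seq (mlast p)) ?mlast_supp ?msupp_uniq //=.
rewrite (raddf_sum (mcoeff _)) (bigD1_seq (mlast q)) ?mlast_supp ?msupp_uniq //=.
rewrite mcoeffZ mcoeffX eqxx mulr1 !big1_seq ?addr0 //.
  move=> m1 /andP[ne1 m1p]; rewrite (raddf_sum (mcoeff _)) big1_seq // => m2 /andP[_ m2q] /=.
  rewrite mcoeffZ mcoeffX; case: eqP => [E|]; rewrite ?mulr0 //.
  have := lemc_lt_add (mlast_lemc m2q) (_ : (mlast p < m1)%O).
  rewrite lt_neqAle eq_sym ne1 mlast_lemc // => /(_ isT).
  by rewrite addmC -E addmC ltxx.
move=> m2 /andP[ne2 m2q]; rewrite mcoeffZ mcoeffX eqm_add2l (negbTE ne2) mulr0 //.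
Qed.

(** Both the largest and the smallest monomials of the factors add up to [K], so in each
    factor they coincide. *)
Lemma monomial_factor (n : nat) (R : idomainType) (p q : {mpoly R[n]}) (K : 'X_{1..n}) :
  p * q = 'X_[K] -> mleadc p * mleadc q = 1 /\ q = mleadc q *: 'X_[mlead q].
Proof.
move=> E; have X0 : 'X_[K] != 0 :> {mpoly R[n]} by rewrite -msupp_eq0 msuppX.
have p0 : p != 0 by apply: contra_neq X0 => p0; rewrite -E p0 mul0r.
have q0 : q != 0 by apply: contra_neq X0 => q0; rewrite -E q0 mulr0.
have Klead : K = (mlead p + mlead q)%MM by rewrite -mleadM // E mleadXm.
split; first by rewrite -mleadcM E mcoeffX Klead eqxx.
have Klast : K = (mlast p + mlast q)%MM.
  apply/eqP; have : (p * q)@_(mlast p + mlast q) != 0.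
    by rewrite mcoeffM_mlast // mulf_neq0 // -mcoeff_msupp mlast_supp.
  by rewrite E mcoeffX; case: (K == _); rewrite ?eqxx.
have ll : mlast q = mlead q.
  apply/eqP; rewrite eq_le mlast_lemc ?mlead_supp //= leNgt; apply/negP => lt.
  have := lemc_lt_add (mlast_lemc (mlead_supp p0)) lt.
  by rewrite -Klead -Klast ltxx.
apply/mpolyP => mm; rewrite mcoeffZ mcoeffX; case: eqVneq => [->|ne]; first by rewrite mulr1.
rewrite mulr0; apply/eqP; rewrite -[_ == 0]negbK -mcoeff_msupp; apply/negP => mq.
by case/negP: ne; rewrite eq_le msupp_le_mlead // -ll mlast_lemc.
Qed.

Lemma int_unit_sign (u v : rat) : u \is a Num.int -> v \is a Num.int -> u * v = 1 -> v = 1 \/ v = -1.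
Proof.
move=> /intrP[a ->] /intrP[b ->] /eqP; rewrite -intrM -[1]/(1%:~R) eqr_int => /eqP h.
have := intUnitRing.unitzPl h; rewrite qualifE /= => /orP[/eqP->|/eqP->]; first by left.
by right; rewrite rmorphN1.
Qed.

Section Unique.
Variables (m : nat) (e e' : 'I_m.+1 -> nat) (r : nat).
Hypothesis e_gt0 : forall k, (0 < e k)%N.
Hypothesis r_gcd : r = \big[gcdn/0%N]_(k < m.+1) e k.
Hypothesis e_re' : forall k, e k = (r * e' k)%N.

Let n := m.+1.
Let S : diagram n := betti_equivariant e' r.
Let s i : {mpoly rat[n]} := betti_poly e' r i.

(** Write the generator as [g] times the equivariant diagram.  The latter is also an
    integral combination of twists of the former, with coefficient polynomial [P], so
    [P g] is a monomial, and [g] is a monomial with coefficient a unit of the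
    integers. *)
Lemma lattice_generator_unique gamma : Lprime e gamma ->
  is_lattice_basis (Lprime_int e) (twist gamma) ->
  exists t, gamma = twist S t \/ gamma = - twist S t.
Proof.
move=> hg [hM hgen _]; have [N [g [N0 hN]]] := Lprime_poly e_gt0 r_gcd e_re' hg.
have twist0 : twist gamma 0 = gamma.
  by apply/eqP/freeg_eqP => -[i a]; rewrite coeff_twist /= addr0.
have ig : int_mpoly g.
  by apply: (Lprime_int_coef e_gt0 e_re' _ hN); rewrite -twist0; apply: hM.
have S_int : Lprime_int e S.
  have -> : S = twist S 0 by apply/eqP/freeg_eqP => -[i a]; rewrite coeff_twist /= addr0.
  exact: Lprime_int_twist_betti.
have [c Sc] := hgen S S_int; rewrite (lattice_lift (V := diagram n)) in Sc.
have [K [K0 good]] := nonneg_translate (dom (rat_freeg c)).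
set P := laurent_poly (rat_freeg c) K.
have iP : int_mpoly P by move=> mm; rewrite coef_laurent_poly // coeff_rat_freeg intr_int.
have nn : nonneg (N + K).
  apply/forallP => k; rewrite mxE addr_ge0 //; [exact: (forallP N0) | exact: (forallP K0)].
have PgX : P * g = 'X_[exponent (N + K)].
  apply: (mulIf (betti_poly_neq0 e_gt0 e_re' ord0)); apply: coefZ_inj => a.
  rewrite coefZXM exponentK // -(coeff_betti e' r) -/S Sc -mulrA.
  by rewrite (coeff_fglift ord0 _ hN good) -addrA subrK.
have [u1 gE] := monomial_factor PgX.
have sgn : mleadc g = 1 \/ mleadc g = -1 by apply: int_unit_sign u1.
exists (N - mnm_row (mlead g)).
have gc i a : coeff (i, a) gamma = mleadc g * coeff (i, a) (twist S (N - mnm_row (mlead g))).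
  by rewrite hN gE -scalerAl coefZZ coefZXM (coeff_twist_betti e' r) addrA -gE.
by case: sgn => us; [left|right]; apply/eqP/freeg_eqP => -[i a];
  rewrite gc us ?mul1r // coeffN mulN1r.
Qed.

End Unique.

Theorem theorem1p2 (n : nat) (n_gt0 : (0 < n)%N) (e e' : 'I_n -> nat) (r : nat)
    (e_gt0 : forall k, (0 < e k)%N)
    (r_gcd : r = \big[gcdn/0%N]_(k < n) e k)
    (e_re' : forall k, e k = (r * e' k)%N) :
  let beta := betti_equivariant e' r in
  [/\ is_lattice_basis (Lprime_int e) (twist beta),
      forall gamma : diagram n,
        Lprime e gamma -> is_lattice_basis (Lprime_int e) (twist gamma) ->
        exists t : 'rV[int]_n, gamma = twist beta t \/ gamma = - twist beta t
    & is_basis (Lprime e) (twist beta)].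
Proof.
case: n n_gt0 e e' e_gt0 r_gcd e_re' => // m _ e e' e_gt0 r_gcd e_re' /=; split.
- exact: lattice_twist_basis.
- exact: lattice_generator_unique.
- exact: rational_twist_basis.
Qed.
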